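(* Let $A\in\{\mathbb{C},\mathbb{H},\mathbb{O}\}$ and let $\widetilde\Omega\subseteq A$ be a circular open set. Let $y\in\widetilde\Omega$ and set $\Omega:=\widetilde\Omega\setminus\mathbb{S}_y$. Suppose $y$ is an essential singularity for $f\in\mathcal{SR}(\Omega)$. Then, for each neighbourhood $U$ of $\mathbb{S}_y$ in $\widetilde\Omega$, the image $f(U\setminus\mathbb{S}_y)$ is dense in $A$.
   Context: $A$ is one of the real $*$-algebras $\mathbb{C},\mathbb{H},\mathbb{O}$ (complex numbers, quaternions, octonions) with standard conjugation $x\mapsto x^c$, Euclidean norm $|\cdot|$ and topology; $t(x)=x+x^c$, $n(x)=xx^c$, $\operatorname{Re}(x)=t(x)/2$, $\operatorname{Im}(x)=x-\operatorname{Re}(x)$; $\mathbb{S}=\{w\in A: w^2=-1\}$, $\mathbb{C}_J=\mathbb{R}+\mathbb{R}J$; for $x=\alpha+\beta J$, $\mathbb{S}_x=\{\alpha+\beta I: I\in\mathbb{S}\}$. For nonempty $D\subseteq\mathbb{C}$ invariant under complex conjugation, $\Omega_D=\{\alpha+\beta J:\alpha,\beta\in\mathbb{R},\,J\in\mathbb{S},\,\alpha+i\beta\in D\}$; sets of this form are called circular. For $D$ open and $\Omega=\Omega_D$, $\mathcal{SR}(\Omega)$ is the set of slice regular functions: functions $f:\Omega\to A$ for which there are $C^1$ functions $F_1,F_2:D\to A$ with $F_1(\bar z)=F_1(z)$, $F_2(\bar z)=-F_2(z)$, $f(\alpha+\beta J)=F_1(\alpha+i\beta)+JF_2(\alpha+i\beta)$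 for all $\alpha+i\beta\in D$, $J\in\mathbb{S}$, and $\partial F_1/\partial\alpha=\partial F_2/\partial\beta$, $\partial F_1/\partial\beta=-\partial F_2/\partial\alpha$. The slice product $f\cdot g$ corresponds to $(F_1G_1-F_2G_2,\;F_1G_2+F_2G_1)$. Let $\Delta_y(x)=x^2-xt(y)+n(y)$. For $n\in\mathbb{Z}$, $(x-y)^{\bullet n}$ is the $n$-th power of $x\mapsto x-y$ with respect to the slice product, where $(x-y)^{-\bullet}=\Delta_y(x)^{-1}(x-y^c)$ on $A\setminus\mathbb{S}_y$; $(x-y)^{\bullet n}\cdot a$ is the slice product with the constant $a$. If $x,y$ lie in a common $\mathbb{C}_J$, set $\sigma(x,y)=\tau(x,y)=|x-y|$; otherwise $\sigma(x,y)=\sqrt{(\operatorname{Re}x-\operatorname{Re}y)^2+(|\operatorname{Im}x|+|\operatorname{Im}y|)^2}$ and $\tau(x,y)=\sqrt{(\operatorname{Re}x-\operatorname{Re}y)^2+(|\operatorname{Im}x|-|\operatorname{Im}y|)^2}$. Let $\Sigma(y,0,R)=\{x\in A:\tau(x,y)>0,\ \sigma(x,y)<R\}$. A point $y$ is a singularity for $f\in\mathcal{SR}(\Omega)$ if $\Sigma(y,0,R)\subseteq\Omega$ for some $R>0$; then there is a unique sequence $\{a_n\}_{n\in\mathbb{Z}}$ in $A$ with $f(x)=\sum_{n\in\mathbb{Z}}(x-y)^{\bullet n}\cdot a_n$ in $\Sigma(y,0,R)$. The point $y$ is a pole for $f$ if there is $m\ge0$ with $a_n=0$ for all $n<-m$;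 otherwise it is an essential singularity for $f$. *)

(* Defs.v *)
From HB Require Import structures.
From mathcomp Require Import all_boot all_order all_algebra.
From mathcomp Require Import all_classical all_reals all_analysis.

Set Implicit Arguments.
Unset Strict Implicit.
Unset Printing Implicit Defensive.

Import Order.TTheory GRing.Theory Num.Theory.
Import numFieldNormedType.Exports.

Local Open Scope classical_set_scope.
Local Open Scope ring_scope.

(** Cayley-Dickson doubling, iterated [k] times from the reals: [cd R 1],
    [cd R 2] and [cd R 3] are the complex numbers, the quaternions and the
    octonions.  The norm carried by the library's product structure is the sup
    norm, which induces the Euclidean topology; the Euclidean norm itself is
    [enorm] below.  A complex number alpha + i beta is the pair
    [(alpha, beta) : cd R 1]. *)
Fixpoint cd (R : realType) (k : nat) : normedModType R :=
  match k with
  | 0 => R^o : normedModType R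
  | k'.+1 => (cd R k' * cd R k')%type : normedModType R
  end.

Section CayleyDickson.
Variable R : realType.

Fixpoint cdconj (k : nat) : cd R k -> cd R k :=
  match k return cd R k -> cd R k with
  | 0 => fun x => x
  | k'.+1 => fun x : cd R k' * cd R k' => (cdconj x.1, - x.2)
  end.

Fixpoint cdmul (k : nat) : cd R k -> cd R k -> cd R k :=
  match k return cd R k -> cd R k -> cd R k with
  | 0 => fun x y : R => x * y
  | k'.+1 => fun x y : cd R k' * cd R k' =>
      (cdmul x.1 y.1 - cdmul (cdconj y.2) x.2, cdmul y.2 x.1 + cdmul x.2 (cdconj y.1))
  end.

(* the embedding of the reals *)
Fixpoint cdreal (k : nat) (r : R) : cd R k :=
  match k return cd R k with
  | 0 => r : R^o
  | k'.+1 => (cdreal k' r, 0) : cd R k' * cd R k'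
  end.

(* the coordinate along 1: t(x)/2 is the real number [cdre x], by [cdtraceE] *)
Fixpoint cdre (k : nat) : cd R k -> R :=
  match k return cd R k -> R with
  | 0 => fun x : R => x
  | k'.+1 => fun x : cd R k' * cd R k' => cdre x.1
  end.

(* the squared Euclidean norm, equal to n(x) by [cdnormE] *)
Fixpoint normsq (k : nat) : cd R k -> R :=
  match k return cd R k -> R with
  | 0 => fun x : R => x ^+ 2
  | k'.+1 => fun x : cd R k' * cd R k' => normsq x.1 + normsq x.2
  end.

End CayleyDickson.

Section Algebra.
Variables (R : realType) (k : nat).
Local Notation A := (cd R k).
Local Notation plane := (cd R 1).
Implicit Types (x y J : A).

Definition cdtrace x : A := x + cdconj x.
Definition cdnorm x : A := cdmul x (cdconj x).
Definition cdim x : A := x - cdreal k (cdre x).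
Definition enorm x : R := Num.sqrt (normsq x).
Definition cdinv x : A := (normsq x)^-1 *: cdconj x.

(* the set S of imaginary units *)
Definition imag_unit : set A := [set w | cdmul w w = - cdreal k 1].

(* the point alpha + beta J, for z = alpha + i beta *)
Definition slice_point (z : plane) J : A := cdreal k z.1 + z.2 *: J.

(* C_J *)
Definition cplane J : set A := [set x | exists z, x = slice_point z J].

(* S_x *)
Definition sphere x : set A :=
  [set w | exists z J I,
     [/\ imag_unit J, imag_unit I, x = slice_point z J & w = slice_point z I]].

(* Omega_D *)
Definition circularization (D : set plane) : set A :=
  [set x | exists z J, [/\ D z, imag_unit J & x = slice_point z J]].

Definition conj_invariant (D : set plane) : Prop := forall z, D z -> D (cdconj z).

Definition circular (Om : set A) : Prop :=
  exists D : set plane, [/\ D !=set0, conj_invariant D & Om = circularization D].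

(* A pair of functions (F1, F2) on the complex plane; only the values on the
   relevant D matter. *)
Definition stem : Type := ((plane -> A) * (plane -> A))%type.

Definition stem_on (D : set plane) (F : stem) : Prop :=
  forall z, D z -> F.1 (cdconj z) = F.1 z /\ F.2 (cdconj z) = - F.2 z.

Definition induces (D : set plane) (F : stem) (f : A -> A) : Prop :=
  forall z J, D z -> imag_unit J -> f (slice_point z J) = F.1 z + cdmul J (F.2 z).

Definition d_alpha (F : plane -> A) (z : plane) : A := 'D_((1, 0) : plane) F z.
Definition d_beta (F : plane -> A) (z : plane) : A := 'D_((0, 1) : plane) F z.

Definition C1_on (D : set plane) (F : plane -> A) : Prop :=
  forall z, D z ->
    [/\ derivable F z ((1, 0) : plane), derivable F z ((0, 1) : plane),
        {for z, continuous (d_alpha F)} & {for z, continuous (d_beta F)}].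

Definition slice_regular (Om : set A) (f : A -> A) : Prop :=
  exists (D : set plane) (F : stem),
    [/\ D !=set0, conj_invariant D, open D & Om = circularization D] /\
    [/\ stem_on D F, induces D F f, C1_on D F.1, C1_on D F.2 &
        forall z, D z -> d_alpha F.1 z = d_beta F.2 z /\
                         d_beta F.1 z = - d_alpha F.2 z].

(* The function induced by a stem F on the whole plane.  At a real x the factor
   [(enorm (cdim x))^-1] is 0 by convention, and F2 vanishes there anyway. *)
Definition slice_fun (F : stem) (x : A) : A :=
  let z : plane := (cdre x, enorm (cdim x)) in
  F.1 z + cdmul ((enorm (cdim x))^-1 *: cdim x) (F.2 z).

(* the (unique) stem inducing a slice function f on A *)
Definition stem_of (f : A -> A) : stem :=
  xget ((fun=> 0, fun=> 0) : stem)
    [set F : stem | stem_on setT F /\ induces setT F f].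

Definition stem_prod (F G : stem) : stem :=
  (fun z => cdmul (F.1 z) (G.1 z) - cdmul (F.2 z) (G.2 z),
   fun z => cdmul (F.1 z) (G.2 z) + cdmul (F.2 z) (G.1 z)).

Definition slice_prod (f g : A -> A) : A -> A :=
  slice_fun (stem_prod (stem_of f) (stem_of g)).

Definition slice_exp (f : A -> A) (n : nat) : A -> A :=
  iter n (slice_prod f) (fun=> cdreal k 1).

Definition Delta y x : A := cdmul x x - cdmul x (cdtrace y) + cdnorm y.

(* (x-y)^{-.}; on S_y, where Delta_y vanishes, it is 0 by convention, so that it
   is a slice function on the whole of A. *)
Definition slice_recip y : A -> A := fun x => cdmul (cdinv (Delta y x)) (x - cdconj y).

Definition slice_pow y (n : int) : A -> A :=
  match n with
  | Posz m => slice_exp (fun x => x - y) m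
  | Negz m => slice_exp (slice_recip y) m.+1
  end.

Definition laurent_term y (a : int -> A) (n : int) : A -> A :=
  slice_prod (slice_pow y n) (fun=> a n).

Definition is_bisum (u : int -> A) (l : A) : Prop :=
  exists l1 l2 : A,
    [/\ series (fun m : nat => u (Posz m)) @ \oo --> l1,
        series (fun m : nat => u (Negz m)) @ \oo --> l2 & l = l1 + l2].

Definition same_slice x y : Prop :=
  exists J, [/\ imag_unit J, cplane J x & cplane J y].

Definition dist_sigma x y : R :=
  if `[< same_slice x y >] then enorm (x - y)
  else Num.sqrt ((cdre x - cdre y) ^+ 2 +
                 (enorm (cdim x) + enorm (cdim y)) ^+ 2).

Definition dist_tau x y : R :=
  if `[< same_slice x y >] then enorm (x - y)
  else Num.sqrt ((cdre x - cdre y) ^+ 2 +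
                 (enorm (cdim x) - enorm (cdim y)) ^+ 2).

(* Sigma(y, 0, r) *)
Definition Sigma_ball y (r : R) : set A := [set x | 0 < dist_tau x y /\ dist_sigma x y < r].

Definition laurent_on (f : A -> A) y (r : R) (a : int -> A) : Prop :=
  forall x, Sigma_ball y r x -> is_bisum (fun n => laurent_term y a n x) (f x).

Definition singularity (Om : set A) y : Prop :=
  exists r : R, 0 < r /\ Sigma_ball y r `<=` Om.

Definition pole (Om : set A) (f : A -> A) y : Prop :=
  exists (r : R) (a : int -> A),
    [/\ 0 < r, Sigma_ball y r `<=` Om, laurent_on f y r a &
        exists m : nat, forall n : int, n < - m%:Z -> a n = 0].

Definition essential_singularity (Om : set A) (f : A -> A) y : Prop :=
  singularity Om y /\ ~ pole Om f y.

End Algebra.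

Section RealValued.
Variable R : realType.

Lemma cdconjK (k : nat) (x : cd R k) : cdconj (cdconj x) = x.
Proof. by elim: k x => [//|k IH] [a b] /=; rewrite IH opprK. Qed.

Lemma cdtraceE (k : nat) (x : cd R k) : cdtrace x = cdreal k (2 * cdre x).
Proof.
rewrite /cdtrace; elim: k x => [|k IH] x; first by rewrite /= mulr_natl mulr2n.
by case: x => a b; rewrite /= -IH; congr pair; rewrite /= subrr.
Qed.

Lemma cdrealD (k : nat) (r s : R) : cdreal k (r + s) = cdreal k r + cdreal k s.
Proof.
elim: k => [//|k IH] /=; rewrite IH.
by congr pair; rewrite /= addr0.
Qed.

Lemma cdconjN (k : nat) (x : cd R k) : cdconj (- x) = - cdconj x.
Proof. by elim: k x => [//|k IH] [a b] /=; rewrite IH. Qed.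

Lemma cdmulN (k : nat) (x y : cd R k) :
  cdmul (- x) y = - cdmul x y /\ cdmul x (- y) = - cdmul x y.
Proof.
elim: k x y => [|k IH] x y; first by rewrite /= mulNr mulrN.
case: x y => [a b] [c d] /=.
split; congr pair; rewrite /= ?cdconjN ?(IH _ _).1 ?(IH _ _).2 //;
  by rewrite ?(IH _ _).1 ?(IH _ _).2 ?opprK ?opprD ?opprK.
Qed.

Lemma cdnormsqE (k : nat) (x : cd R k) :
  cdmul x (cdconj x) = cdreal k (normsq x) /\
  cdmul (cdconj x) x = cdreal k (normsq x).
Proof.
elim: k x => [|k IH] x; first by rewrite /= expr2.
case: x => [a b] /=.
rewrite cdconjK !cdconjN !(cdmulN _ _).1 !(cdmulN _ _).2.
rewrite !(IH _).1 !(IH _).2 !opprK cdrealD.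
by split; congr pair; rewrite /= ?cdconjK ?addNr ?subrr.
Qed.

Lemma cdnormE (k : nat) (x : cd R k) : cdnorm x = cdreal k (normsq x).
Proof. exact: (cdnormsqE x).1. Qed.

End RealValued.

(* Main.v *)
Require Import Defs.
From HB Require Import structures.
From mathcomp Require Import all_boot all_order all_algebra.
From mathcomp Require Import all_classical all_reals all_analysis.
From mathcomp Require Import complex ring lra.

Set Implicit Arguments.
Unset Strict Implicit.
Unset Printing Implicit Defensive.

Import Order.TTheory GRing.Theory Num.Theory.
Import numFieldNormedType.Exports.

Local Open Scope classical_set_scope.
Local Open Scope ring_scope.
Import ComplexField.Normc.

(** Suppose that [f] stays at distance at least [e] from [c] near the sphere of [y],
    and let (F1, F2) be the stem of [f - c], an A-valued holomorphic pair on a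
    punctured disc around z0.  The complexified squared norm h = |F1|^2 - |F2|^2 +
    2i<F1, F2> is a scalar holomorphic function, and |h|^2 is the product of the
    extreme values of |F1 + J F2|^2 over the imaginary units J.  Hence
    e^2 (|F1|^2 + |F2|^2) <= |h|^2 and |h| >= e^2: the function 1/h is bounded, so it
    has a zero of finite order at z0, h is O(|z - z0|^-m), and so are F1 and F2.  Each
    real component of the stem is then a Laurent series with finite principal part.
    On the slice of J the spherical power (x - y)^(.n) is the ordinary power in the
    plane of J as soon as y lies in that plane, so the Laurent series of the stem
    evaluates to the expansion of [f] at [y], which is therefore a pole.

    The scalar complex analysis rests on Cauchy's formula for C^1 holomorphic
    functions: the derivative in t of f(w + t(zeta - w)) zeta / (zeta - w) is a
    derivative along the circle, so its circle integral does not depend on t. *)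

(** * Cayley-Dickson algebras *)

Section CayleyDicksonAlgebra.
Variable R : realType.
Implicit Types k : nat.

(** An ordinary complex function [f - c] could simply be inverted. The complexification of [A]
    however has zero divisors, such as [1 + i J] and [1 - i J], and the form [h] vanishes on them.
    If [h] vanishes at (F1, F2), then [F1 + J F2 = 0] for some unit [J]; this is excluded because
    [f] avoids the ball on a full neighbourhood of the sphere, for all [J] at once.

    A second obstacle lies in the definition of [pole]: one sequence of coefficients has to work on
    a whole [Sigma_ball], whereas a stem expansion evaluated on the slice of [J] has coefficients
    [b1 + J b2]. For non-real [y] the radius is kept below the norm of the imaginary part of [y], so
    that the ball stays in one slice; for real [y] every slice is met, and the parity of the stem
    removes [b2]. *)

Lemma cdconjD k (x y : cd R k) : cdconj (x + y) = cdconj x + cdconj y.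
Proof. by elim: k x y => [//|k IH] [a b] [c d] /=; rewrite IH opprD. Qed.

Lemma cdconjZ k (r : R) (x : cd R k) : cdconj (r *: x) = r *: cdconj x.
Proof. by elim: k x => [//|k IH] [a b] /=; rewrite IH -scalerN. Qed.

Lemma cdmulD k (x y z : cd R k) :
  cdmul (x + y) z = cdmul x z + cdmul y z /\ cdmul z (x + y) = cdmul z x + cdmul z y.
Proof.
elim: k x y z => [|k IH] x y z; first by split; [exact: mulrDl|exact: mulrDr].
have IHl (u v w : cd R k) : cdmul (u + v) w = cdmul u w + cdmul v w by case: (IH u v w).
have IHr (u v w : cd R k) : cdmul u (v + w) = cdmul u v + cdmul u w by case: (IH v w u).
by move: x y z => [a b] [c d] [e f] /=; split; congr pair;
  rewrite /= ?cdconjD !IHl !IHr ?opprD addrACA.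
Qed.

Lemma cdmulDl k (x y z : cd R k) : cdmul (x + y) z = cdmul x z + cdmul y z.
Proof. by case: (cdmulD x y z). Qed.

Lemma cdmulDr k (x y z : cd R k) : cdmul x (y + z) = cdmul x y + cdmul x z.
Proof. by case: (cdmulD y z x). Qed.

Lemma cdmulNl k (x y : cd R k) : cdmul (- x) y = - cdmul x y.
Proof. by case: (cdmulN x y). Qed.

Lemma cdmulNr k (x y : cd R k) : cdmul x (- y) = - cdmul x y.
Proof. by case: (cdmulN x y). Qed.

Lemma cdmulZ k (r : R) (x y : cd R k) :
  cdmul (r *: x) y = r *: cdmul x y /\ cdmul x (r *: y) = r *: cdmul x y.
Proof.
elim: k x y => [|k IH] x y.
  by split; rewrite /GRing.scale /=; [rewrite mulrA|rewrite mulrCA].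
have IHl (u v : cd R k) : cdmul (r *: u) v = r *: cdmul u v by case: (IH u v).
have IHr (u v : cd R k) : cdmul u (r *: v) = r *: cdmul u v by case: (IH u v).
by move: x y => [a b] [c d] /=; split; congr pair;
  rewrite /= ?cdconjZ !IHl !IHr ?scalerBr ?scalerDr.
Qed.

Lemma cdmulZl k (r : R) (x y : cd R k) : cdmul (r *: x) y = r *: cdmul x y.
Proof. by case: (cdmulZ r x y). Qed.

Lemma cdmulZr k (r : R) (x y : cd R k) : cdmul x (r *: y) = r *: cdmul x y.
Proof. by case: (cdmulZ r x y). Qed.

Lemma cdmul0x k (x : cd R k) : cdmul 0 x = 0.
Proof. by have := cdmulZl 0 0 x; rewrite !scale0r. Qed.

Lemma cdmulx0 k (x : cd R k) : cdmul x 0 = 0.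
Proof. by have := cdmulZr 0 x 0; rewrite !scale0r. Qed.

Lemma cdconj0 k : cdconj (0 : cd R k) = 0.
Proof. by have := cdconjZ 0 (0 : cd R k); rewrite !scale0r. Qed.

Lemma cdreal0 k : cdreal k (0 : R) = 0.
Proof. by elim: k => //= k ->. Qed.

Lemma cdrealZ k (r s : R) : cdreal k (r * s) = r *: cdreal k s.
Proof. by elim: k => //= k ->; congr pair; rewrite scaler0. Qed.

Lemma cdrealE k (r : R) : cdreal k r = r *: cdreal k 1.
Proof. by rewrite -cdrealZ mulr1. Qed.

Lemma cdrealN k (r : R) : cdreal k (- r) = - cdreal k r.
Proof. by rewrite -mulN1r cdrealZ scaleN1r. Qed.

Lemma cdconj_real k (r : R) : cdconj (cdreal k r) = cdreal k r.
Proof. by elim: k => //= k ->; rewrite oppr0. Qed.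

Lemma cdmul1 k (x : cd R k) : cdmul (cdreal k 1) x = x /\ cdmul x (cdreal k 1) = x.
Proof.
elim: k x => [|k IH] x; first by rewrite /= mul1r mulr1.
have IHl (u : cd R k) : cdmul (cdreal k 1) u = u by case: (IH u).
have IHr (u : cd R k) : cdmul u (cdreal k 1) = u by case: (IH u).
move: x => [a b] /=; rewrite cdconj0 cdconj_real !cdmul0x !cdmulx0 !IHl !IHr.
by split; congr pair; rewrite /= ?subr0 ?addr0 ?add0r.
Qed.

Lemma cdmul_reall k (r : R) (x : cd R k) : cdmul (cdreal k r) x = r *: x.
Proof. by rewrite cdrealE cdmulZl; case: (cdmul1 x) => ->. Qed.

Lemma cdmul_realr k (r : R) (x : cd R k) : cdmul x (cdreal k r) = r *: x.
Proof. by rewrite cdrealE cdmulZr; case: (cdmul1 x) => _ ->. Qed.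

Fixpoint cddot k : cd R k -> cd R k -> R :=
  match k return cd R k -> cd R k -> R with
  | 0 => fun x y : R => x * y
  | k'.+1 => fun x y : cd R k' * cd R k' => cddot x.1 y.1 + cddot x.2 y.2
  end.

Lemma cdreD k (x y : cd R k) : cdre (x + y) = cdre x + cdre y.
Proof. by elim: k x y => [//|k IH] [a b] [c d] /=; rewrite IH. Qed.

Lemma cdreZ k (r : R) (x : cd R k) : cdre (r *: x) = r * cdre x.
Proof. by elim: k x => [//|k IH] [a b] /=; rewrite IH. Qed.

Lemma cdreN k (x : cd R k) : cdre (- x) = - cdre x.
Proof. by rewrite -scaleN1r cdreZ mulN1r. Qed.

Lemma cdre_real k (r : R) : cdre (cdreal k r) = r.
Proof. by elim: k => //= k ->. Qed.

Lemma normsq_ge0 k (x : cd R k) : 0 <= normsq x.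
Proof. by elim: k x => [|k IH] x; [exact: sqr_ge0|rewrite /= addr_ge0]. Qed.

Lemma normsq_eq0 k (x : cd R k) : normsq x = 0 -> x = 0.
Proof.
elim: k x => [|k IH] x; first by move=> /= /eqP; rewrite sqrf_eq0 => /eqP.
case: x => a b /= /eqP; rewrite paddr_eq0 ?normsq_ge0// => /andP[/eqP/IH -> /eqP/IH ->].
by [].
Qed.

Lemma normsqZ k (r : R) (x : cd R k) : normsq (r *: x) = r ^+ 2 * normsq x.
Proof.
elim: k x => [|k IH] x; first by rewrite /= exprMn.
by rewrite /= !IH mulrDr.
Qed.

Lemma normsqN k (x : cd R k) : normsq (- x) = normsq x.
Proof. by rewrite -scaleN1r normsqZ sqrrN expr1n mul1r. Qed.

Lemma normsq0 k : normsq (0 : cd R k) = 0.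
Proof. by rewrite -(scale0r (0 : cd R k)) normsqZ expr0n mul0r. Qed.

Lemma normsq_real k (r : R) : normsq (cdreal k r) = r ^+ 2.
Proof. by elim: k => //= k ->; rewrite normsq0 addr0. Qed.

Lemma normsqD k (x y : cd R k) :
  normsq (x + y) = normsq x + normsq y + 2 * cddot x y.
Proof.
elim: k x y => [|k IH] x y; first by rewrite /= ; ring.
by move: x y => [a b] [c d] /=; rewrite !IH; ring.
Qed.

Lemma cddotZl k (r : R) (x y : cd R k) : cddot (r *: x) y = r * cddot x y.
Proof.
elim: k x y => [|k IH] x y; first by rewrite /= mulrA.
by rewrite /= !IH mulrDr.
Qed.

Lemma cddotDr k (x y z : cd R k) : cddot x (y + z) = cddot x y + cddot x z.
Proof.
elim: k x y z => [|k IH] x y z; first by rewrite /= mulrDr.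
by rewrite /= !IH addrACA.
Qed.

Lemma cddotxx k (x : cd R k) : cddot x x = normsq x.
Proof. by elim: k x => [|k IH] x; [rewrite /= expr2|rewrite /= !IH]. Qed.

Lemma cddotC k (x y : cd R k) : cddot x y = cddot y x.
Proof.
elim: k x y => [|k IH] x y; first by rewrite /= mulrC.
by rewrite /= IH (IH x.2).
Qed.

Lemma cddot0x k (x : cd R k) : cddot 0 x = 0.
Proof. by rewrite -(scale0r (0 : cd R k)) cddotZl mul0r. Qed.

Lemma cddot_real k (x : cd R k) (r : R) : cddot x (cdreal k r) = r * cdre x.
Proof.
elim: k x => [|k IH] x; first by rewrite /= mulrC.
by rewrite /= IH cddotC cddot0x addr0.
Qed.

Lemma cdre_im k (x : cd R k) : cdre (cdim x) = 0.
Proof. by rewrite /cdim cdreD cdreN cdre_real subrr. Qed.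

Lemma re_addim k (x : cd R k) : cdreal k (cdre x) + cdim x = x.
Proof. by rewrite /cdim addrC subrK. Qed.

Lemma normsq_reim k (x : cd R k) : normsq x = cdre x ^+ 2 + normsq (cdim x).
Proof.
rewrite -[in LHS](re_addim x) addrC normsqD cddot_real cdre_im mulr0 mulr0 addr0.
by rewrite normsq_real addrC.
Qed.

Lemma cdconjE k (x : cd R k) : cdconj x = cdreal k (2 * cdre x) - x.
Proof. by rewrite -cdtraceE /cdtrace addrAC subrr add0r. Qed.

(** As [cdconj x] is [2 Re x - x], the identity [x x^c = n(x)] is a quadratic equation for [x],
    valid at every level of the doubling. *)
Lemma cdsqrE k (x : cd R k) : cdmul x x = (2 * cdre x) *: x - cdreal k (normsq x).
Proof.
have [<- _] := cdnormsqE x.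
by rewrite cdconjE cdmulDr cdmul_realr cdmulNr opprB addrC subrK.
Qed.

(** By the quadratic equation a square root of -1 with nonzero real part would itself be real, which
    is impossible. *)
Lemma imag_unitP k (J : cd R k) : imag_unit J <-> cdre J = 0 /\ normsq J = 1.
Proof.
rewrite /imag_unit /mkset cdsqrE; split=> [H|[-> ->]]; last first.
  by rewrite mulr0 scale0r add0r.
have HZ : (2 * cdre J) *: J = cdreal k (normsq J - 1).
  by rewrite cdrealD cdrealN -H addrC subrK.
have := congr1 (@cdre R k) HZ; rewrite cdreZ cdre_real => Hre.
have := congr1 (@normsq R k) HZ; rewrite normsqZ normsq_real -Hre => Hn.
have [re0|re0] := eqVneq (cdre J) 0; first by split => //; move: Hre; rewrite re0; lra.
exfalso; have : normsq J = cdre J ^+ 2.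
  apply: (@mulfI _ ((2 * cdre J) ^+ 2)); first by rewrite expf_neq0// mulf_neq0.
  by rewrite Hn; ring.
by have := sqr_ge0 (cdre J); nra.
Qed.

Definition basic_unit k : cd R k :=
  match k with 0 => 0 | k'.+1 => (0, cdreal k' 1) end.

Lemma imag_unit_basic k : (0 < k)%N -> imag_unit (basic_unit k).
Proof.
case: k => // k _; apply/imag_unitP => /=; rewrite normsq0 add0r normsq_real expr1n.
by split => //; rewrite -(scale0r (0 : cd R k)) cdreZ mul0r.
Qed.

Lemma imag_unitN k (J : cd R k) : imag_unit J -> imag_unit (- J).
Proof. by move=> /imag_unitP[J0 J1]; apply/imag_unitP; rewrite cdreN normsqN J0 oppr0. Qed.

Lemma cdre_slice k (z : cd R 1) (J : cd R k) : imag_unit J -> cdre (slice_point z J) = z.1.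
Proof. by move=> /imag_unitP[J0 _]; rewrite cdreD cdreZ cdre_real J0 mulr0 addr0. Qed.

Lemma cdim_slice k (z : cd R 1) (J : cd R k) : imag_unit J -> cdim (slice_point z J) = z.2 *: J.
Proof. by move=> SJ; rewrite /cdim cdre_slice// /slice_point addrAC subrr add0r. Qed.

Lemma enormZ k (r : R) (x : cd R k) : enorm (r *: x) = `|r| * enorm x.
Proof. by rewrite /enorm normsqZ sqrtrM ?sqr_ge0// sqrtr_sqr. Qed.

Lemma enorm_unit k (J : cd R k) : imag_unit J -> enorm J = 1.
Proof. by move=> /imag_unitP[_ J1]; rewrite /enorm J1 sqrtr1. Qed.

Lemma enorm_cdim_slice k (z : cd R 1) (J : cd R k) : imag_unit J ->
  enorm (cdim (slice_point z J)) = `|z.2|.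
Proof. by move=> SJ; rewrite cdim_slice// enormZ enorm_unit// mulr1. Qed.

Lemma slice_pointB k (z w : cd R 1) (J : cd R k) :
  slice_point z J - slice_point w J = slice_point (z - w) J.
Proof. by rewrite /slice_point /= opprD addrACA -scaleNr -scalerDl -cdrealN -cdrealD. Qed.

Lemma slice_point_conj k (z : cd R 1) (J : cd R k) : slice_point (cdconj z) (- J) = slice_point z J.
Proof. by rewrite /slice_point /= scalerN scaleNr opprK. Qed.

Lemma normsq_slice k (z : cd R 1) (J : cd R k) : imag_unit J -> normsq (slice_point z J) = normsq z.
Proof.
move=> SJ; rewrite normsq_reim cdre_slice// cdim_slice// normsqZ.
by case/imag_unitP: SJ => _ ->; rewrite mulr1.
Qed.

Lemma slice_decomposition k (x : cd R k) : (0 < k)%N ->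
  exists2 J, imag_unit J & x = slice_point (cdre x, enorm (cdim x)) J.
Proof.
move=> k0; have [im0|im0] := eqVneq (cdim x) 0.
  exists (basic_unit k); first exact: imag_unit_basic.
  by rewrite -[LHS]re_addim /slice_point /= im0 /enorm normsq0 sqrtr0 scale0r.
have e0 : 0 < enorm (cdim x).
  rewrite sqrtr_gt0 lt_def normsq_ge0 andbT.
  by apply: contra im0 => /eqP/normsq_eq0 ->.
exists ((enorm (cdim x))^-1 *: cdim x); last first.
  by rewrite /slice_point /= scalerA divff ?gt_eqF// scale1r re_addim.
apply/imag_unitP; rewrite cdreZ cdre_im mulr0 normsqZ; split => //.
by rewrite -[X in _ * X](sqr_sqrtr (normsq_ge0 _)) -exprMn mulVf ?gt_eqF// expr1n.
Qed.

Lemma slice_point_inj k (z w : cd R 1) (J I : cd R k) : imag_unit J -> imag_unit I ->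
  slice_point z J = slice_point w I -> w = z \/ w = cdconj z.
Proof.
move=> SJ SI E.
have := congr1 (@cdre R k) E; rewrite !cdre_slice// => E1.
have := congr1 (@enorm R k \o @cdim R k) E; rewrite /= !enorm_cdim_slice// => /eqP.
rewrite eqr_norm2; case: z w {E} E1 => [a b] [c d] /= -> /orP[/eqP ->|/eqP ->]; first by left.
by right; rewrite opprK.
Qed.

End CayleyDicksonAlgebra.

(** * Alternativity and the multiplicative norm in dimensions 2, 4 and 8 *)

Section CompositionAlgebra.
Variables (R : realType) (k : nat).
Hypothesis hk : (1 <= k <= 3)%N.
Local Notation A := (cd R k).

(** This is what replaces associativity for the octonions: later reassociations go through it by way
    of [cdmul_unitK]. It fails one doubling further. *)
Lemma cdmul_alternative (x y : A) : cdmul x (cdmul x y) = cdmul (cdmul x x) y.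
Proof.
case: k hk x y => [|[|[|[|//]]]] // _.
- by move=> [a b] [a' b'] /=; congr pair => /=; ring.
- by move=> [[a b] [c d]] [[a' b'] [c' d']] /=; congr pair => /=; congr pair => /=; ring.
- move=> [[[a b] [c d]] [[e f] [g h]]] [[[a' b'] [c' d']] [[e' f'] [g' h']]] /=.
  by congr pair => /=; congr pair => /=; congr pair => /=; ring.
Qed.

Lemma normsqM (x y : A) : normsq (cdmul x y) = normsq x * normsq y.
Proof.
case: k hk x y => [|[|[|[|//]]]] // _.
- by move=> [a b] [a' b'] /=; ring.
- by move=> [[a b] [c d]] [[a' b'] [c' d']] /=; ring.
- move=> [[[a b] [c d]] [[e f] [g h]]] [[[a' b'] [c' d']] [[e' f'] [g' h']]] /=.
  by ring.
Qed.

(** Right multiplications by [y] and by its conjugate are adjoint; the scalar product of [J G2] with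
    [G1] thus becomes that of [J] with [G1 G2^c]. *)
Lemma cddot_mul (x y z : A) : cddot (cdmul x y) z = cddot x (cdmul z (cdconj y)).
Proof.
case: k hk x y z => [|[|[|[|//]]]] // _.
- by move=> [a b] [a' b'] [a1 b1] /=; ring.
- by move=> [[a b] [c d]] [[a' b'] [c' d']] [[a1 b1] [c1 d1]] /=; ring.
- move=> [[[a b] [c d]] [[e f] [g h]]] [[[a' b'] [c' d']] [[e' f'] [g' h']]]
    [[[a1 b1] [c1 d1]] [[e1 f1] [g1 h1]]] /=.
  by ring.
Qed.

Lemma normsq_conj (x : A) : normsq (cdconj x) = normsq x.
Proof. by rewrite cdconjE normsqD normsqN cddotC cddot_real cdreN normsq_real; ring. Qed.

Lemma cdmul_unitK (J x : A) : imag_unit J -> cdmul J (cdmul J x) = - x.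
Proof. by move=> SJ; rewrite cdmul_alternative SJ cdmulNl cdmul_reall scale1r. Qed.

(* The product of the extreme values of [normsq (G1 + J G2)] over the imaginary
   units J is the squared modulus on the right-hand side. *)
Lemma slice_norm_bound (G1 G2 : A) : exists2 J, imag_unit J &
  normsq (G1 + cdmul J G2) * (normsq G1 + normsq G2) <=
    (normsq G1 - normsq G2) ^+ 2 + (2 * cddot G1 G2) ^+ 2.
Proof.
have k0 : (0 < k)%N by case/andP: hk.
pose P := cdmul G1 (cdconj G2).
have reP : cdre P = cddot G1 G2.
  have := cddot_mul (cdreal k 1) G2 G1; rewrite cdmul_reall scale1r.
  by rewrite [RHS]cddotC cddot_real mul1r cddotC => <-.
have [J SJ PE] := slice_decomposition P k0.
pose s := enorm (cdim P).
have s0 : 0 <= s := sqrtr_ge0 _.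
have sE : normsq G1 * normsq G2 = cddot G1 G2 ^+ 2 + s ^+ 2.
  by rewrite -[normsq G2]normsq_conj -normsqM normsq_reim -/P reP sqr_sqrtr ?normsq_ge0.
(* With [N = normsq G1 + normsq G2], the squared norm of [G1 + I G2] ranges from [N - 2 s] to
   [N + 2 s] over the units [I]; the minimum is at [- J]. *)
exists (- J); first exact: imag_unitN.
have E : normsq (G1 + cdmul (- J) G2) = normsq G1 + normsq G2 - 2 * s.
  rewrite normsqD cdmulNl normsqN normsqM.
  have [J0 ->] := (imag_unitP J).1 SJ.
  rewrite cddotC -scaleN1r cddotZl cddot_mul -/P PE cddotDr cddot_real J0 mulr0 add0r.
  by rewrite cddotC cddotZl cddotxx /= ((imag_unitP J).1 SJ).2 -/s; ring.
have := normsq_ge0 (G1 + cdmul (- J) G2); rewrite E => E0.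
(* By [sE] the right-hand side is [(N - 2 s)(N + 2 s)], and the second factor is at least [N]. *)
nra.
Qed.

End CompositionAlgebra.

(** * Complex numbers: topology and derivatives *)

(* [R[i]] is a [numFieldType], but unification does not find the topology that the
   library puts on an abstract [numFieldType]. *)
HB.instance Definition _ (R : realType) :=
  NormedModule.copy R[i] (R[i] : numFieldType)^o.

Section ComplexTopology.
Variable R : realType.
Local Notation C := (R[i]).
Local Notation normc := (@normc R).
Local Open Scope complex_scope.

Lemma normcE (z : C) : `|z| = (normc z)%:C.
Proof. by case: z. Qed.

Lemma normc_ge0 (z : C) : 0 <= normc z.
Proof. by case: z => a b; exact: sqrtr_ge0. Qed.

Lemma ler_normcD (x y : C) : normc (x + y) <= normc x + normc y.
Proof. exact: le_normcD. Qed.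

Lemma normc_distC (x y : C) : normc (x - y) = normc (y - x).
Proof. by rewrite -normcN opprB. Qed.

Lemma ler_normcB (x y : C) : normc x - normc y <= normc (x - y).
Proof. by rewrite lerBlDr -[in leLHS](subrK y x) ler_normcD. Qed.

Lemma normc_eq0 (z : C) : (normc z == 0) = (z == 0).
Proof.
apply/eqP/eqP => [/eq0_normc //|->].
exact: normc0.
Qed.

Lemma normc_gt0 (z : C) : (0 < normc z) = (z != 0).
Proof. by rewrite lt_def normc_ge0 andbT normc_eq0. Qed.

Lemma normcX (z : C) n : normc (z ^+ n) = normc z ^+ n.
Proof.
elim: n => [|n IH]; first by rewrite !expr0 normc1.
by rewrite !exprS normcM IH.
Qed.

Lemma normc_real (r : R) : normc r%:C = `|r|.
Proof. by rewrite /= expr0n /= addr0 sqrtr_sqr. Qed.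

Lemma normRe_le (z : C) : `|complex.Re z| <= normc z.
Proof. by rewrite -lecR -normcE; exact: normc_ge_Re. Qed.

Lemma normIm_le (z : C) : `|complex.Im z| <= normc z.
Proof.
by case: z => a b /=; rewrite -sqrtr_sqr ler_wsqrtr // lerDr sqr_ge0.
Qed.

Lemma normc_le_ReIm (z : C) : normc z <= `|complex.Re z| + `|complex.Im z|.
Proof.
rewrite -(ler_pXn2r (n := 2)) ?nnegrE ?normc_ge0 ?addr_ge0//.
case: z => a b /=; rewrite sqr_sqrtr ?addr_ge0 ?sqr_ge0//.
rewrite sqrrD !real_normK ?num_real// -addrA lerD2l lerDr.
by rewrite mulrn_wge0 ?mulr_ge0.
Qed.

Lemma ccvgP {T : Type} (F : set_system T) {FF : Filter F} (f : T -> C) (l : C) :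
  f @ F --> l <-> forall e : R, 0 < e -> \forall t \near F, normc (f t - l) < e.
Proof.
split=> [/cvgrPdist_lt fl e e0|fl].
  have /fl : 0 < e%:C :> C by rewrite ltcR.
  by apply: filterS => t; rewrite normcE ltcR normc_distC.
apply/cvgrPdist_lt => e e0.
have [r r0 ->] : exists2 r : R, 0 < r & e = r%:C.
  by case: e e0 => a b; rewrite ltcE /= => /andP[/eqP -> a0]; exists a.
by apply: filterS (fl r r0) => t; rewrite normcE ltcR normc_distC.
Qed.

Lemma cvg_Re {T : Type} (F : set_system T) {FF : Filter F} (f : T -> C) (l : C) :
  f @ F --> l -> complex.Re (f t) @[t --> F] --> complex.Re l.
Proof.
move=> /ccvgP fl; apply/cvgrPdist_lt => e /fl; apply: filterS => t.
by apply: le_lt_trans; rewrite distrC -raddfB normRe_le.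
Qed.

Lemma cvg_Im {T : Type} (F : set_system T) {FF : Filter F} (f : T -> C) (l : C) :
  f @ F --> l -> complex.Im (f t) @[t --> F] --> complex.Im l.
Proof.
move=> /ccvgP fl; apply/cvgrPdist_lt => e /fl; apply: filterS => t.
by apply: le_lt_trans; rewrite distrC -raddfB normIm_le.
Qed.

Lemma cvg_complex {T : Type} (F : set_system T) {FF : Filter F} (u v : T -> R)
    (a b : R) : u @ F --> a -> v @ F --> b -> (u t +i* v t) @[t --> F] --> a +i* b.
Proof.
move=> /cvgrPdist_lt ua /cvgrPdist_lt vb; apply/ccvgP => e e0.
have e20 : 0 < e / 2 by rewrite divr_gt0.
near=> t; apply: le_lt_trans (normc_le_ReIm _) _.
rewrite (splitr e) /=; apply: ltrD; rewrite distrC; near: t.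
- exact: ua.
- exact: vb.
Unshelve. all: by end_near. Qed.

Lemma nbhs_normcP (z : C) (P : set C) :
  nbhs z P <-> exists2 r : R, 0 < r & forall w, normc (w - z) < r -> P w.
Proof.
split=> [/nbhs_ballP[e /= e0 zP]|[r r0 zP]].
  have [r r0 er] : exists2 r : R, 0 < r & e = r%:C.
    by case: e {zP} e0 => a b; rewrite ltcE /= => /andP[/eqP -> a0]; exists a.
  exists r => // w wz; apply: zP.
  by rewrite -ball_normE /ball_ /= er normcE ltcR normc_distC.
apply/nbhs_ballP; exists r%:C => [|w]; first by rewrite /= ltcR.
by rewrite -ball_normE /ball_ /= normcE ltcR normc_distC; exact: zP.
Qed.

Lemma dnbhs_normcP (z : C) (P : set C) : z^' P <->
  exists2 r : R, 0 < r & forall w, normc (w - z) < r -> w != z -> P w.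
Proof. by split=> /nbhs_normcP. Qed.

End ComplexTopology.

(** * Complex derivatives and derivatives along real paths *)

Section Derivatives.
Variable R : realType.
Local Notation C := (R[i]).
Local Notation normc := (@normc R).
Local Open Scope complex_scope.

Lemma is_deriveP (K : numFieldType) (V W : normedModType K) (f : V -> W) (a v : V) (d : W) :
  is_derive a v f d <-> h^-1 *: (f (h *: v + a) - f a) @[h --> 0^'] --> d.
Proof.
split=> [[fv <-]|fd]; first exact: fv.
by split; [apply/cvg_ex; exists d|exact: cvg_lim fd].
Qed.

(** The parameter is real while [R[i]] is normed over itself, so the derivative is split into two
    real ones, the form in which the real integrals use it. *)
Definition path_deriv (g : R -> C) (t : R) (d : C) : Prop :=
  is_derive t 1 (fun s => complex.Re (g s)) (complex.Re d) /\
  is_derive t 1 (fun s => complex.Im (g s)) (complex.Im d).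

Lemma path_derivP (g : R -> C) (t : R) (d : C) :
  path_deriv g t d <-> (h^-1)%:C * (g (h + t) - g t) @[h --> (0 : R)^'] --> d.
Proof.
have eqRe h : h^-1 *: (complex.Re (g (h *: 1 + t)) - complex.Re (g t)) =
    complex.Re ((h^-1)%:C * (g (h + t) - g t)).
  rewrite [h *: 1]mulr1; case: (g (h + t)) (g t) => a b [c e] /=.
  by rewrite mul0r subr0.
have eqIm h : h^-1 *: (complex.Im (g (h *: 1 + t)) - complex.Im (g t)) =
    complex.Im ((h^-1)%:C * (g (h + t) - g t)).
  rewrite [h *: 1]mulr1; case: (g (h + t)) (g t) => a b [c e] /=.
  by rewrite mul0r addr0.
split=> [[/is_deriveP dr /is_deriveP di]|gd].
  have := cvg_complex dr di; under eq_fun do rewrite eqRe eqIm.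
  suff -> : (fun h : R => (h^-1)%:C * (g (h + t) - g t)) = (fun h =>
      complex.Re ((h^-1)%:C * (g (h + t) - g t)) +i*
      complex.Im ((h^-1)%:C * (g (h + t) - g t))).
    by case: d {dr di} => dr di H; exact: H.
  by apply/funext => h; case: (_ * _).
split; apply/is_deriveP.
- by under eq_fun do rewrite eqRe; exact: cvg_Re gd.
- by under eq_fun do rewrite eqIm; exact: cvg_Im gd.
Qed.

Lemma path_deriv_continuous (g : R -> C) (t : R) (d : C) : path_deriv g t d -> {for t, continuous g}.
Proof.
move=> [[dr _] [di _]].
have -> : g = (fun s => complex.Re (g s) +i* complex.Im (g s)).
  by apply/funext => s; case: (g s).
by apply: cvg_complex; apply: differentiable_continuous; apply/derivable1_diffP.
Qed.

(** Caratheodory's form of the derivative: filled in at [z], the quotient is continuous there, and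
    the chain rule needs no special case for [g (h + t) = g t]. *)
Definition slope (f : C -> C) (z d w : C) : C :=
  if w == z then d else (f w - f z) / (w - z).

Lemma slopeE (f : C -> C) (z d w : C) : f w - f z = slope f z d w * (w - z).
Proof.
rewrite /slope; have [->|wz] := eqVneq w z; first by rewrite !subrr mulr0.
by rewrite mulfVK// subr_eq0.
Qed.

Lemma slope_continuous (f : C -> C) (z d : C) : is_derive z 1 f d ->
  slope f z d w @[w --> z] --> d.
Proof.
move=> /is_deriveP /ccvgP fd; apply/(@ccvgP R _ (nbhs z)) => e e0.
have /dnbhs_normcP[r r0 H] := fd e e0.
apply/nbhs_normcP; exists r => // w zw.
rewrite /slope; have [_|wz] := eqVneq w z.
  by rewrite subrr normc0.
have := H (w - z); rewrite subr0 subr_eq0 => /(_ zw wz).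
rewrite (_ : (w - z) *: 1 + z = w); last by rewrite [_ *: _]mulr1 subrK.
by rewrite [_ *: _]mulrC.
Qed.

Lemma is_derive_continuous (f : C -> C) (z d : C) : is_derive z 1 f d -> {for z, continuous f}.
Proof.
move=> fd; apply: differentiable_continuous; apply/derivable1_diffP.
by case: fd.
Qed.

Lemma path_deriv_comp (f : C -> C) (g : R -> C) (t : R) (d e : C) :
  path_deriv g t d -> is_derive (g t) 1 f e -> path_deriv (f \o g) t (e * d).
Proof.
move=> gd fe; apply/path_derivP.
have -> : (fun h => (h^-1)%:C * ((f \o g) (h + t) - (f \o g) t)) =
  (fun h => slope f (g t) e (g (h + t)) * ((h^-1)%:C * (g (h + t) - g t))).
  by apply/funext => h; rewrite /= (slopeE f (g t) e); ring.
apply: (@cvgM C); last exact/path_derivP.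
apply: cvg_comp (slope_continuous fe).
apply: cvg_within_filter.
have /path_deriv_continuous := gd.
rewrite /continuous_at /= => gt.
apply: (cvg_comp (G := nbhs t) _ _ _ gt).
have : h + t @[h --> (0 : R)] --> 0 + t.
  by apply: cvgD; [exact: cvg_id|exact: cvg_cst].
by rewrite add0r.
Qed.

Lemma path_deriv_affine (g : R -> C) (t : R) (d a b : C) :
  path_deriv g t d -> path_deriv (fun s => a * g s + b) t (a * d).
Proof.
move=> gd; apply: (path_deriv_comp (f := fun z => a * z + b) gd).
have -> : (fun z : C => a * z + b) = (a \*: (id : C -> C) + cst b).
  by apply/funext => z.
apply: is_derive_eq.
by rewrite addr0 [_ *: _]mulr1.
Qed.

Lemma path_deriv_real (t : R) : path_deriv (fun s : R => s%:C) t 1.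
Proof.
by split; rewrite /=; [exact: is_derive_id|exact: is_derive_cst].
Qed.

End Derivatives.

(** * Cauchy's formula and Taylor expansions *)

Section CircleIntegral.
Variable R : realType.
Local Notation C := (R[i]).
Local Notation normc := (@normc R).
Local Notation mu := (@lebesgue_measure R).
Local Notation I := (`[0, 2 * pi]%classic : set R).
Local Open Scope complex_scope.

Lemma continuous_integrable_circle (g : R -> R) :
  continuous g -> mu.-integrable I (EFin \o g).
Proof.
move=> cg; apply: continuous_compact_integrable; first exact: segment_compact.
exact: continuous_subspaceT.
Qed.

Lemma Rintegral_derive (g G : R -> R) : continuous g ->
  (forall x : R, is_derive x 1 G (g x)) ->
  \int[mu]_(x in I) g x = G (2 * pi) - G 0.
Proof.
move=> cg dG; have pi0 : 0 < 2 * pi :> R by rewrite mulr_gt0 ?pi_gt0.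
have cG : continuous G.
  move=> x; apply: differentiable_continuous; apply/derivable1_diffP.
  by case: (dG x).
rewrite /Rintegral (continuous_FTC2 (F := G) pi0) //.
- exact: continuous_subspaceT.
- split.
  + by move=> x _; case: (dG x).
  + by apply: cvg_at_right_filter; exact: cG.
  + by apply: cvg_at_left_filter; exact: cG.
- by move=> x _; rewrite derive1E; case: (dG x).
Qed.

(** Differentiation under the integral sign gives the integral of [dphi t] over a period, which
    vanishes by the periodic primitive. Domination is asked on an open interval around [0, 1], the
    primitive only on ]0, 1[: the one for Cauchy's formula divides by [t], and the mean value
    theorem is content with the interior. *)
Lemma Rintegral_homotopy (phi dphi : R -> R -> R) (u v M : R) : u < 0 -> 1 < v ->
  (forall t : R, u < t < v -> continuous (phi t)) ->
  (forall (t x : R), u < t < v -> is_derive t 1 (phi^~ x) (dphi t x)) ->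
  (forall (t x : R), u < t < v -> `|dphi t x| <= M) ->
  (forall t : R, 0 < t < 1 -> continuous (dphi t)) ->
  (forall t : R, 0 < t < 1 -> exists2 psi : R -> R,
     forall x : R, is_derive x 1 psi (dphi t x) & psi 0 = psi (2 * pi)) ->
  \int[mu]_(x in I) phi 0 x = \int[mu]_(x in I) phi 1 x.
Proof.
move=> u0 v1 cphi dphiE dphiM cdphi prim.
pose F t := \int[mu]_(x in I) phi t x.
have M0 : 0 <= M by apply: le_trans (dphiM 0 0 _) => //; rewrite u0 (lt_trans _ v1).
have part t x : u < t < v -> partial1of2 phi t x = dphi t x.
  by move=> tuv; rewrite partial1of2E; case: (dphiE t x tuv).
have intphi t : `]u, v[%classic t -> mu.-integrable I (EFin \o phi t).
  by rewrite /= in_itv /= => tuv; exact: continuous_integrable_circle (cphi t tuv).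
have derphi t x : `]u, v[%classic t -> I x -> derivable (phi^~ x) t 1.
  by rewrite /= in_itv /= => tuv _; case: (dphiE t x tuv).
have intM : mu.-integrable I (EFin \o cst M).
  by apply: continuous_integrable_circle => x; exact: cvg_cst.
have bndphi t x : `]u, v[%classic t -> I x -> `|partial1of2 phi t x| <= M.
  by rewrite /= in_itv /= => tuv _; rewrite part// dphiM.
have dF t : u < t < v -> derivable F t 1.
  move=> tuv; apply: (derivable_under_integral (u := u) (v := v) _ _ intphi derphi
    (fun=> M0) intM bndphi) => //.
have F'0 (t : R) : t \in `]0, 1[ -> is_derive t 1 F 0.
  rewrite in_itv /= => t01; have /andP[t0 t1] := t01.
  have tuv : u < t < v by rewrite (lt_trans u0) // (lt_trans t1).
  split; first exact: dF.
  rewrite -derive1E (differentiation_under_integral (u := u) (v := v) _ _ intphi derphi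
    (fun=> M0) intM bndphi) //.
  under eq_Rintegral do rewrite part//.
  have [psi dpsi psi0] := prim t t01.
  by rewrite (Rintegral_derive (cdphi t t01) dpsi) psi0 subrr.
have cF : {within `[0, 1], continuous F}.
  apply: derivable_within_continuous => t; rewrite in_itv /= => /andP[t0 t1].
  by apply: dF; rewrite (lt_le_trans u0)//= (le_lt_trans t1).
have [c _] := MVT ltr01 F'0 cF.
by rewrite mul0r => /eqP; rewrite subr_eq0 => /eqP.
Qed.

(** Integration is against the angle and not against [dz = i zeta dx]; hence the factor [zeta] in
    the kernels and the normalisation [2 pi] in place of [2 pi i]. *)
Definition circle_int (g : R -> C) : C :=
  (\int[mu]_(x in I) complex.Re (g x)) +i* (\int[mu]_(x in I) complex.Im (g x)).

Lemma continuous_Re (g : R -> C) : continuous g -> continuous (fun x => complex.Re (g x)).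
Proof. by move=> cg x; apply: cvg_Re; exact: cg. Qed.

Lemma continuous_Im (g : R -> C) : continuous g -> continuous (fun x => complex.Im (g x)).
Proof. by move=> cg x; apply: cvg_Im; exact: cg. Qed.

Let intR (g : R -> C) (cg : continuous g) := continuous_integrable_circle (continuous_Re cg).
Let intI (g : R -> C) (cg : continuous g) := continuous_integrable_circle (continuous_Im cg).

Lemma circle_intD (f g : R -> C) : continuous f -> continuous g ->
  circle_int (fun x => f x + g x) = circle_int f + circle_int g.
Proof.
move=> cf cg; rewrite /circle_int.
rewrite -[RHS]/((_ + _) +i* (_ + _)) -!RintegralD//; try by (exact: intR || exact: intI).
by congr (_ +i* _); apply: eq_Rintegral => x _; rewrite raddfD.
Qed.

Lemma circle_intZ (a : C) (g : R -> C) : continuous g ->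
  circle_int (fun x => a * g x) = a * circle_int g.
Proof.
move=> cg; case: a => a b; rewrite /circle_int.
rewrite -[RHS]/((a * _ - b * _) +i* (a * _ + b * _)).
have iR (c : R) : mu.-integrable I (EFin \o (fun x => c * complex.Re (g x))).
  by apply: continuous_integrable_circle => x; apply: (@cvgMl_tmp R); exact: continuous_Re.
have iI (c : R) : mu.-integrable I (EFin \o (fun x => c * complex.Im (g x))).
  by apply: continuous_integrable_circle => x; apply: (@cvgMl_tmp R); exact: continuous_Im.
rewrite -!RintegralZl//; try by (exact: intR || exact: intI).
rewrite -RintegralB// -RintegralD//.
by congr (_ +i* _); apply: eq_Rintegral => x _; case: (g x).
Qed.

Lemma circle_int_cst (a : C) : circle_int (fun=> a) = a * (2 * pi)%:C.
Proof.
rewrite /circle_int !Rintegral_cst//= lebesgue_measure_itv /= lte_fin mulr_gt0 ?pi_gt0//= subr0.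
by case: a => a b; congr (_ +i* _); rewrite /= ?mulr0 ?subr0 ?add0r.
Qed.

Lemma continuous_csum (g : nat -> R -> C) N : (forall n, continuous (g n)) ->
  continuous (fun x => \sum_(n < N) g n x).
Proof.
move=> cg; elim: N => [|N IH].
  rewrite (_ : (fun x => _) = fun=> 0); first by move=> x; exact: cvg_cst.
  by apply/funext => x; rewrite big_ord0.
rewrite (_ : (fun x => _) = fun x => \sum_(i < N) g i x + g N x); last first.
  by apply/funext => x; rewrite big_ord_recr.
by move=> x; apply: (@cvgD _ C); [exact: IH|exact: cg].
Qed.

Lemma circle_int_sum (g : nat -> R -> C) N : (forall n, continuous (g n)) ->
  circle_int (fun x => \sum_(n < N) g n x) = \sum_(n < N) circle_int (g n).
Proof.
move=> cg; elim: N => [|N IH].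
  rewrite big_ord0 (_ : (fun x => _) = fun=> 0) ?circle_int_cst ?mul0r//.
  by apply/funext => x; rewrite big_ord0.
rewrite big_ord_recr /= -IH -circle_intD//.
  by congr circle_int; apply/funext => x; rewrite big_ord_recr.
exact: continuous_csum.
Qed.

(** Real and imaginary parts are bounded separately by [2 pi M], at the cost of a factor 2 that
    reappears in the Taylor bounds. *)
Lemma circle_int_le (g : R -> C) (M : R) : continuous g -> (forall x, normc (g x) <= M) ->
  normc (circle_int g) <= 4 * pi * M.
Proof.
move=> cg gM.
have aux (h : R -> R) : continuous h -> (forall x, `|h x| <= M) ->
    `|\int[mu]_(x in I) h x| <= 2 * pi * M.
  move=> ch hM; apply: le_trans (le_normr_Rintegral _ _) _ => //.
    exact: continuous_integrable_circle.
  apply: (@le_trans _ _ (\int[mu]_(x in I) M)).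
    apply: le_Rintegral => //; last first.
      by apply: continuous_integrable_circle => x; exact: cvg_cst.
    apply: continuous_integrable_circle => x.
    by apply: (@cvg_norm _ R); exact: ch.
  rewrite Rintegral_cst//= lebesgue_measure_itv /= lte_fin mulr_gt0 ?pi_gt0//= subr0.
  by rewrite mulrC.
apply: le_trans (normc_le_ReIm _) _.
rewrite (_ : 4 * pi * M = 2 * pi * M + 2 * pi * M); last by ring.
apply: lerD; apply: aux.
- exact: continuous_Re.
- by move=> x; apply: le_trans (normRe_le _) _.
- exact: continuous_Im.
- by move=> x; apply: le_trans (normIm_le _) _.
Qed.

Lemma circle_int_homotopy (phi dphi : R -> R -> C) (u v M : R) : u < 0 -> 1 < v ->
  (forall t : R, u < t < v -> continuous (phi t)) ->
  (forall (t x : R), u < t < v -> path_deriv (phi^~ x) t (dphi t x)) ->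
  (forall (t x : R), u < t < v -> normc (dphi t x) <= M) ->
  (forall t : R, 0 < t < 1 -> continuous (dphi t)) ->
  (forall t : R, 0 < t < 1 -> exists2 psi : R -> C,
     forall x : R, path_deriv psi x (dphi t x) & psi 0 = psi (2 * pi)) ->
  circle_int (phi 0) = circle_int (phi 1).
Proof.
move=> u0 v1 cphi dphiE dphiM cdphi prim; rewrite /circle_int; congr (_ +i* _).
- apply: (@Rintegral_homotopy (fun t x => complex.Re (phi t x))
    (fun t x => complex.Re (dphi t x)) u v M) => //.
  + by move=> t tuv; apply: continuous_Re; exact: cphi.
  + by move=> t x tuv; case: (dphiE t x tuv).
  + by move=> t x tuv; apply: le_trans (normRe_le _) _; exact: dphiM.
  + by move=> t t01; apply: continuous_Re; exact: cdphi.
  + move=> t t01; have [psi dpsi psi0] := prim t t01.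
    exists (fun x => complex.Re (psi x)); last by rewrite psi0.
    by move=> x; case: (dpsi x).
- apply: (@Rintegral_homotopy (fun t x => complex.Im (phi t x))
    (fun t x => complex.Im (dphi t x)) u v M) => //.
  + by move=> t tuv; apply: continuous_Im; exact: cphi.
  + by move=> t x tuv; case: (dphiE t x tuv).
  + by move=> t x tuv; apply: le_trans (normIm_le _) _; exact: dphiM.
  + by move=> t t01; apply: continuous_Im; exact: cdphi.
  + move=> t t01; have [psi dpsi psi0] := prim t t01.
    exists (fun x => complex.Im (psi x)); last by rewrite psi0.
    by move=> x; case: (dpsi x).
Qed.

End CircleIntegral.

(** * Cauchy's formula on a circle centred at the origin *)

Section CauchyFormula.
Variable R : realType.
Local Notation C := (R[i]).
Local Notation normc := (@normc R).
Local Open Scope complex_scope.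

Definition circle_pt (r x : R) : C := (r * cos x) +i* (r * sin x).

Lemma normc_circle_pt (r x : R) : 0 <= r -> normc (circle_pt r x) = r.
Proof.
move=> r0; rewrite /circle_pt /= !exprMn -mulrDr cos2Dsin2 mulr1.
by rewrite sqrtr_sqr ger0_norm.
Qed.

Lemma eq_path_deriv (f g : R -> C) (t : R) (d : C) : f =1 g -> path_deriv f t d -> path_deriv g t d.
Proof. by move=> /funext ->. Qed.

Lemma circle_pt_neq0 (r x : R) : 0 < r -> circle_pt r x != 0.
Proof. by move=> r0; rewrite -normc_gt0 normc_circle_pt// ltW. Qed.

Lemma circle_pt_periodic (r : R) : circle_pt r (2 * pi) = circle_pt r 0.
Proof. by rewrite /circle_pt mulr_natl cos2pi sin2pi cos0 sin0. Qed.

Lemma path_deriv_circle_pt (r x : R) : path_deriv (circle_pt r) x ('i * circle_pt r x).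
Proof.
split; rewrite /circle_pt /=.
  rewrite mul0r mul1r sub0r.
  have -> : (fun s : R => r * cos s) = (r \*: (cos : R -> R)) by apply/funext.
  by apply: is_derive_eq; rewrite scalerN.
rewrite mul0r mul1r add0r.
have -> : (fun s : R => r * sin s) = (r \*: (sin : R -> R)) by apply/funext.
exact: is_deriveZ.
Qed.

Lemma continuous_circle_pt (r : R) : continuous (circle_pt r).
Proof. by move=> x; apply: path_deriv_continuous (path_deriv_circle_pt r x). Qed.

Lemma continuous_path (F : C -> C) (g : R -> C) : continuous g ->
  (forall x, {for g x, continuous F}) -> continuous (fun x => F (g x)).
Proof. by move=> cg cF x; apply: continuous_comp; [exact: cg|exact: cF]. Qed.

Lemma is_derive_div (a z : C) : z != 0 -> is_derive z 1 (fun w : C => a / w) (- a / z ^+ 2).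
Proof.
move=> z0.
have dV : is_derive z 1 (fun w : C => w^-1) (- (z ^- 2)).
  split; first by apply: (@derivableV _ _ id) => //; exact: derivable_id.
  by rewrite (@deriveV _ _ id) ?derive_id//= ?[_ *: 1]mulr1//; exact: derivable_id.
have -> : (fun w : C => a / w) = (a \*: (fun w : C => w^-1)) by apply/funext.
by apply: is_derive_eq; rewrite [_ *: _]mulrN mulNr.
Qed.

Lemma continuous_divl (a z : C) : z != 0 -> {for z, continuous (fun w : C => a / w)}.
Proof. by move=> z0; apply: is_derive_continuous (is_derive_div a z0). Qed.

Lemma continuous_invc (z : C) : z != 0 -> {for z, continuous (fun w : C => w^-1)}.
Proof.
move=> z0; have := @continuous_divl 1 z z0; rewrite (_ : (fun w : C => 1 / w) = fun w : C => w^-1)//.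
by apply/funext => w; rewrite mul1r.
Qed.

Lemma continuous_affine (a b : C) (g : R -> C) :
  continuous g -> continuous (fun x => a * g x + b).
Proof.
move=> cg x; apply: (@cvgD _ C); last exact: cvg_cst.
by apply: (@cvgM C); [exact: cvg_cst|exact: cg].
Qed.

Lemma continuousMC (f g : R -> C) : continuous f -> continuous g ->
  continuous (fun x => f x * g x).
Proof. by move=> cf cg x; apply: (@cvgM C); [exact: cf|exact: cg]. Qed.

(** Shrink [w] to 0: the derivative in [t] of [zeta / (zeta - t w)] is the angular derivative of
    [i w / (zeta - t w)], and at [t = 0] the integrand is 1. *)
Lemma cauchy_kernel (r : R) (w : C) : normc w < r ->
  circle_int (fun x => circle_pt r x / (circle_pt r x - w)) = (2 * pi)%:C.
Proof.
move=> wr; have r0 : 0 < r by apply: le_lt_trans wr; exact: normc_ge0.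
(* Overrunning [0, 1] by [d] lengthens [t w] by at most [d r = h], so that [zeta - t w] keeps norm
   at least [h]. *)
pose d := (r - normc w) / (2 * r).
have d0 : 0 < d by rewrite divr_gt0 ?subr_gt0 ?mulr_gt0.
pose h := (r - normc w) / 2.
have h0 : 0 < h by rewrite divr_gt0 ?subr_gt0.
have far t x : - d < t < 1 + d -> h <= normc (circle_pt r x - t%:C * w).
  move=> /andP[t1 t2].
  have tn : `|t| <= 1 + d by rewrite ler_norml; apply/andP; split; lra.
  apply: le_trans (ler_normcB _ _).
  rewrite normc_circle_pt ?(ltW r0)// normcM normc_real.
  have : `|t| * normc w <= (1 + d) * normc w by rewrite ler_wpM2r ?normc_ge0.
  have : d * normc w <= d * r by rewrite ler_wpM2l ?ltW.
  rewrite (_ : d * r = h); last by rewrite /d /h; field; rewrite gt_eqF.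
  by rewrite /h; lra.
have nz t x : - d < t < 1 + d -> circle_pt r x - t%:C * w != 0.
  by move=> /(far t x); rewrite -normc_gt0; exact: lt_le_trans.
have cden (t : R) : continuous (fun x => circle_pt r x - t%:C * w).
  move=> x; apply: (@cvgB _ C); [exact: continuous_circle_pt|exact: cvg_cst].
have cinv (a : C) (t : R) : - d < t < 1 + d -> continuous (fun x => a / (circle_pt r x - t%:C * w)).
  move=> td; apply: (continuous_path (F := fun z => a / z)) => // x.
  by apply: continuous_divl; exact: nz.
transitivity (circle_int (fun x => circle_pt r x / (circle_pt r x - 1%:C * w))); first by rewrite mul1r.
rewrite -(@circle_int_homotopy R (fun t x => circle_pt r x / (circle_pt r x - t%:C * w))
  (fun t x => circle_pt r x * w / (circle_pt r x - t%:C * w) ^+ 2) (- d) (1 + d)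
  (r * normc w / h ^+ 2)).
- rewrite (_ : (fun x => _) = fun=> 1) ?circle_int_cst ?mul1r//.
  by apply/funext => x; rewrite mul0r subr0 divff// circle_pt_neq0.
- by rewrite oppr_lt0.
- by rewrite ltrDl.
- move=> t td; apply: continuousMC; first exact: continuous_circle_pt.
  by have := cinv 1 t td; under eq_fun do rewrite mul1r.
- move=> t x td.
  have := path_deriv_comp (path_deriv_affine (- w) (circle_pt r x) (path_deriv_real t)).
  move=> /(_ (fun z => circle_pt r x / z) (- circle_pt r x / (circle_pt r x - t%:C * w) ^+ 2)) H.
  rewrite (_ : circle_pt r x * w / _ =
    - circle_pt r x / (circle_pt r x - t%:C * w) ^+ 2 * (- w * 1)); last by ring.
  have e (s : R) : - w * s%:C + circle_pt r x = circle_pt r x - s%:C * w by ring.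
  have -> : (fun s : R => circle_pt r x / (circle_pt r x - s%:C * w)) =
    (fun z => circle_pt r x / z) \o (fun s : R => - w * s%:C + circle_pt r x).
    by apply/funext => s /=; rewrite e.
  by apply: H; rewrite e; apply: is_derive_div; exact: nz.
- move=> t x td; rewrite !normcM normc_circle_pt ?(ltW r0)//.
  rewrite normcV normcX ler_wpM2l//.
    by rewrite mulr_ge0 ?normc_ge0 ?ltW.
  rewrite lef_pV2 ?posrE ?exprn_gt0//; last first.
    by rewrite (lt_le_trans h0) ?far.
  by rewrite ler_pXn2r ?nnegrE ?normc_ge0 ?(ltW h0) ?far.
- move=> t /andP[t0 t1]; have td : - d < t < 1 + d by apply/andP; split; lra.
  under eq_fun do rewrite expr2 invfM mulrA.
  apply: continuousMC; last by have := cinv 1 t td; under eq_fun do rewrite mul1r.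
  under eq_fun do rewrite -mulrA.
  by apply: continuousMC; [exact: continuous_circle_pt|exact: cinv].
- move=> t /andP[t0 t1]; have td : - d < t < 1 + d by apply/andP; split; lra.
  exists (fun x => ('i * w) / (circle_pt r x - t%:C * w)); last by rewrite circle_pt_periodic.
  move=> x.
  have := path_deriv_comp (path_deriv_affine 1 (- (t%:C * w)) (path_deriv_circle_pt r x)).
  rewrite !mul1r.
  move=> /(_ (fun z => 'i * w / z) (- ('i * w) / (circle_pt r x - t%:C * w) ^+ 2)) H.
  rewrite (_ : circle_pt r x * w / _ =
    - ('i * w) / (circle_pt r x - t%:C * w) ^+ 2 * ('i * circle_pt r x)); last first.
    rewrite (_ : _ * ('i * _) = - ('i ^+ 2) * (w * circle_pt r x) /
       (circle_pt r x - t%:C * w) ^+ 2); last by ring.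
    by rewrite sqr_i opprK mul1r [w * _]mulrC.
  have -> : (fun y : R => 'i * w / (circle_pt r y - t%:C * w)) =
    (fun z => 'i * w / z) \o (fun s : R => 1 * circle_pt r s - t%:C * w).
    by apply/funext => s /=; rewrite mul1r.
  by apply: H; apply: is_derive_div; exact: nz.
Qed.

Lemma cauchy_formula (f f' : C -> C) (s r B : R) (w : C) : normc w < r -> r < s ->
  (forall z : C, normc z < s -> is_derive z 1 f (f' z)) ->
  (forall z : C, normc z < s -> {for z, continuous f'}) ->
  (forall z : C, normc z < s -> normc (f' z) <= B) ->
  circle_int (fun x => f (circle_pt r x) * (circle_pt r x / (circle_pt r x - w))) = f w * (2 * pi)%:C.
Proof.
move=> wr rs df cf' f'B.
have r0 : 0 < r by apply: le_lt_trans wr; exact: normc_ge0.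
(* The point [t zeta + (1 - t) w] has norm at most [(1 + 2 d) r], which this [d] makes
   [r + (s - r) / 2 < s]. *)
pose d := (s - r) / (4 * r).
have d0 : 0 < d by rewrite divr_gt0 ?subr_gt0 ?mulr_gt0.
have nzw x : circle_pt r x - w != 0.
  rewrite -normc_gt0; apply: lt_le_trans (ler_normcB _ _).
  by rewrite normc_circle_pt ?subr_gt0 ?(ltW r0).
have near t x : - d < t < 1 + d -> normc (t%:C * (circle_pt r x - w) + w) < s.
  move=> /andP[t1 t2].
  rewrite (_ : _ + w = t%:C * circle_pt r x + (1 - t)%:C * w); last first.
    by rewrite rmorphB rmorph1; ring.
  apply: le_lt_trans (ler_normcD _ _) _.
  rewrite !normcM !normc_real normc_circle_pt ?(ltW r0)//.
  have : `|1 - t| * normc w <= `|1 - t| * r by rewrite ler_wpM2l// ltW.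
  have : (`|t| + `|1 - t|) * r <= (1 + 2 * d) * r.
    rewrite ler_pM2r//.
    by have [?|?] := ger0P t; have [?|?] := ger0P (1 - t); lra.
  have : (1 + 2 * d) * r < s.
    rewrite (_ : (1 + _) * r = r + (s - r) / 2); last first.
      by rewrite /d; field; rewrite gt_eqF.
    by lra.
  by lra.
have cden (t : R) : continuous (fun x => t%:C * (circle_pt r x - w) + w).
  apply: continuous_affine => x.
  by apply: (@cvgB _ C); [exact: continuous_circle_pt|exact: cvg_cst].
have cker : continuous (fun x => circle_pt r x / (circle_pt r x - w)).
  apply: continuousMC; first exact: continuous_circle_pt.
  apply: (continuous_path (F := fun z => z^-1)).
    by move=> x; apply: (@cvgB _ C); [exact: continuous_circle_pt|exact: cvg_cst].
  by move=> x; exact: continuous_invc.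
transitivity (circle_int (fun x => f (1%:C * (circle_pt r x - w) + w) * (circle_pt r x / (circle_pt r x - w)))).
  by congr circle_int; apply/funext => x; rewrite mul1r subrK.
rewrite -(@circle_int_homotopy R (fun t x => f (t%:C * (circle_pt r x - w) + w) *
    (circle_pt r x / (circle_pt r x - w)))
  (fun t x => f' (t%:C * (circle_pt r x - w) + w) * circle_pt r x) (- d) (1 + d) (B * r)).
- rewrite -(cauchy_kernel wr)// -circle_intZ//.
  by congr circle_int; apply/funext => x; rewrite mul0r add0r.
- by rewrite oppr_lt0.
- by rewrite ltrDl.
- move=> t td; apply: continuousMC cker.
  apply: (@continuous_path f _ (cden t)) => x.
  exact: is_derive_continuous (df _ (near t x td)).
- move=> t x td.
  have := path_deriv_affine (circle_pt r x / (circle_pt r x - w)) 0 (path_deriv_comp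
    (path_deriv_affine (circle_pt r x - w) w (path_deriv_real t)) (df _ _)).
  have e (a : R) : (circle_pt r x - w) * a%:C + w = a%:C * (circle_pt r x - w) + w by ring.
  rewrite e => /(_ (near t x td)).
  rewrite (_ : _ / _ * _ = f' (t%:C * (circle_pt r x - w) + w) * circle_pt r x); last first.
    by field.
  by apply: eq_path_deriv => a /=; rewrite addr0 e mulrC.
- move=> t x td; rewrite normcM normc_circle_pt ?(ltW r0)//.
  by rewrite ler_pM2r// f'B// near.
- move=> t /andP[t0 t1]; have td : - d < t < 1 + d by apply/andP; split; lra.
  apply: continuousMC; last exact: continuous_circle_pt.
  by apply: (@continuous_path f' _ (cden t)) => x; apply: cf'; exact: near.
- move=> t /andP[t0 t1]; have td : - d < t < 1 + d by apply/andP; split; lra.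
  (* The angular derivative of [f (w + t (zeta - w))] carries the factor [i t zeta], of which only
     [zeta] is wanted; the division uses [0 < t]. *)
  exists (fun x => ('i * t%:C)^-1 * f (t%:C * (circle_pt r x - w) + w) + 0);
    last by rewrite circle_pt_periodic.
  move=> x.
  have := path_deriv_affine ('i * t%:C)^-1 0 (path_deriv_comp
    (path_deriv_affine t%:C (w - t%:C * w) (path_deriv_circle_pt r x)) (df _ _)).
  have e (a : R) : t%:C * circle_pt r a + (w - t%:C * w) = t%:C * (circle_pt r a - w) + w by ring.
  rewrite e => /(_ (near t x td)).
  rewrite (_ : _^-1 * _ = f' (t%:C * (circle_pt r x - w) + w) * circle_pt r x); last first.
    have tn0 : t%:C != 0 by rewrite -normc_gt0 normc_real normr_gt0 gt_eqF.
    have in0 : 'i != 0 :> C by rewrite eq_complex /= oner_eq0 andbF.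
    by field; apply/andP; split; [exact: tn0|exact: in0].
  by apply: eq_path_deriv => a /=; rewrite addr0 e addr0.
Qed.

End CauchyFormula.

(** * Taylor polynomials with geometric remainder *)

Section Taylor.
Variable R : realType.
Local Notation C := (R[i]).
Local Notation normc := (@normc R).
Local Open Scope complex_scope.

Lemma geometric_remainder (F : fieldType) (z w : F) N : z != 0 -> z - w != 0 ->
  z / (z - w) = \sum_(n < N) (w / z) ^+ n + (w / z) ^+ N * (z / (z - w)).
Proof.
move=> z0 zw; elim: N => [|N IH]; first by rewrite big_ord0 add0r expr0 mul1r.
rewrite big_ord_recr /= [LHS]IH -addrA; congr (_ + _).
by rewrite exprSr; field; rewrite zw z0.
Qed.

(** The kernel in Cauchy's formula is expanded as a finite geometric series with remainder. One
    factor 2 comes from [circle_int_le], the other bounds [zeta / (zeta - w)] for [|w| <= r / 2].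
    The bound [B] only serves as domination in Cauchy's formula. *)
Lemma taylor (f f' : C -> C) (s r B M : R) : 0 < r -> r < s ->
  (forall z : C, normc z < s -> is_derive z 1 f (f' z)) ->
  (forall z : C, normc z < s -> {for z, continuous f'}) ->
  (forall z : C, normc z < s -> normc (f' z) <= B) ->
  (forall z : C, normc z = r -> normc (f z) <= M) ->
  exists2 c : nat -> C, forall n, normc (c n) <= 2 * M / r ^+ n &
    forall (w : C) N, normc w <= r / 2 ->
      normc (f w - \sum_(n < N) c n * w ^+ n) <= 4 * M * (normc w / r) ^+ N.
Proof.
move=> r0 rs df cf' f'B fM.
have pi0 : 0 < pi :> R := pi_gt0 R.
have pin0 : (2 * pi)%:C != 0 :> C by rewrite -normc_gt0 normc_real normr_gt0 gt_eqF ?mulr_gt0.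
have M0 : 0 <= M by apply: le_trans (normc_ge0 _) (fM (circle_pt r 0) _); rewrite normc_circle_pt ?ltW.
have npi : normc (2 * pi)%:C = 2 * pi by rewrite normc_real ger0_norm ?mulr_ge0 ?ltW.
have cfc : continuous (fun x => f (circle_pt r x)).
  apply: (@continuous_path _ f _ (@continuous_circle_pt R r)) => x.
  by apply: is_derive_continuous (df _ _); rewrite normc_circle_pt ?ltW.
have cinvc : continuous (fun x => (circle_pt r x)^-1).
  apply: (@continuous_path _ (fun z => z^-1) _ (@continuous_circle_pt R r)) => x.
  by apply: continuous_invc; exact: circle_pt_neq0.
have cinvX n : continuous (fun x => (circle_pt r x)^-1 ^+ n).
  elim: n => [|n IH]; first by move=> x; exact: cvg_cst.
  by under eq_fun do rewrite exprS; exact: continuousMC cinvc IH.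
pose c n := (2 * pi)%:C^-1 * circle_int (fun x => f (circle_pt r x) * (circle_pt r x)^-1 ^+ n).
exists c => [n|w N wr2].
  rewrite /c normcM normcV npi.
  rewrite mulrC ler_pdivrMr ?mulr_gt0//.
  rewrite (_ : _ * (2 * pi) = 4 * pi * (M / r ^+ n)); last by ring.
  apply: (circle_int_le (continuousMC cfc (cinvX n))).
  move=> x; rewrite normcM normcX normcV.
  rewrite normc_circle_pt ?(ltW r0)// -exprVn ler_wpM2r ?exprn_ge0 ?invr_ge0 ?(ltW r0)//.
  by rewrite fM// normc_circle_pt ?ltW.
have wr : normc w < r by lra.
have nzw x : circle_pt r x - w != 0.
  rewrite -normc_gt0; apply: lt_le_trans (ler_normcB _ _).
  by rewrite normc_circle_pt ?subr_gt0 ?(ltW r0).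
have cker : continuous (fun x => circle_pt r x / (circle_pt r x - w)).
  apply: continuousMC; first exact: continuous_circle_pt.
  apply: (@continuous_path _ (fun z => z^-1) (fun x => circle_pt r x - w)).
    by move=> x; apply: (@cvgB _ C); [exact: continuous_circle_pt|exact: cvg_cst].
  by move=> x; exact: continuous_invc.
pose g n x := w ^+ n * (f (circle_pt r x) * (circle_pt r x)^-1 ^+ n).
pose h x := w ^+ N * (f (circle_pt r x) * (circle_pt r x)^-1 ^+ N) * (circle_pt r x / (circle_pt r x - w)).
have cg n : continuous (g n).
  apply: continuousMC (continuousMC cfc (cinvX n)) => x; exact: cvg_cst.
have ch : continuous h by exact: (continuousMC (cg N) cker).
have csum : continuous (fun x => \sum_(n < N) g n x) by exact: continuous_csum.
have E : f w * (2 * pi)%:C = \sum_(n < N) circle_int (g n) + circle_int h.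
  rewrite -(cauchy_formula wr rs df cf' f'B) -circle_int_sum// -circle_intD//.
  congr circle_int; apply/funext => x.
  rewrite (geometric_remainder N (circle_pt_neq0 x r0) (nzw x)) mulrDr mulr_sumr.
  congr (_ + _); last by rewrite /h exprMn; ring.
  by apply: eq_bigr => n _; rewrite /g exprMn; ring.
have -> : f w - \sum_(n < N) c n * w ^+ n = (2 * pi)%:C^-1 * circle_int h.
  apply: (mulfI pin0); rewrite mulVKf// mulrBr mulrC E mulr_sumr.
  rewrite addrAC -sumrB big1 ?add0r// => n _.
  rewrite /g (circle_intZ _ (continuousMC cfc (cinvX n))).
  by rewrite /c mulrA mulVKf// mulrC subrr.
rewrite normcM normcV npi.
rewrite mulrC ler_pdivrMr ?mulr_gt0//.
rewrite (_ : _ * (2 * pi) = 4 * pi * (M * (normc w / r) ^+ N * 2)); last by ring.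
apply: circle_int_le => // x.
rewrite /h !(normcM, normcX, normcV).
rewrite normc_circle_pt ?(ltW r0)// exprMn.
rewrite (_ : M * _ * 2 = (normc w ^+ N * (M * r^-1 ^+ N)) * 2); last by ring.
have w0 := normc_ge0 w.
apply: ler_pM.
- by rewrite !mulr_ge0 ?exprn_ge0 ?invr_ge0 ?normc_ge0 ?(ltW r0).
- by rewrite mulr_ge0 ?invr_ge0 ?normc_ge0 ?(ltW r0).
- rewrite ler_wpM2l ?exprn_ge0// ler_wpM2r ?exprn_ge0 ?invr_ge0 ?(ltW r0)//.
  by rewrite fM// normc_circle_pt ?ltW.
- have := ler_normcB (circle_pt r x) w; rewrite normc_circle_pt ?(ltW r0)// => H.
  rewrite ler_pdivrMr; first by lra.
  by apply: lt_le_trans H; rewrite subr_gt0.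
Qed.

End Taylor.

(** * Isolated singularities *)

Section Punctured.
Variable R : realType.
Local Notation C := (R[i]).
Local Notation normc := (@normc R).
Local Open Scope complex_scope.

Lemma bounded_on_disc (F : C -> C) (a s : R) : a < s ->
  (forall z : C, normc z < s -> {for z, continuous F}) ->
  exists B : R, forall z : C, normc z <= a -> normc (F z) <= B.
Proof.
move=> as_ cF.
pose toC (p : R * R) : C := p.1 +i* p.2.
have ctoC (p : R * R) : {for p, continuous toC}.
  by apply: cvg_complex; [exact: cvg_fst|exact: cvg_snd].
have cK : compact (`[- a, a]%classic `*` `[- a, a]%classic : set (R * R)).
  by apply: compact_setX; exact: segment_compact.
have /compact_near_coveringP := cK.
move=> /(_ R (pinfty_nbhs R) (fun M p => normc (toC p) <= a -> normc (F (toC p)) <= M) _).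
case.
  move=> p _ /=; have [ps|sp] := ltrP (normc (toC p)) s.
    have /(@ccvgP R _ (nbhs p)) H : F (toC q) @[q --> p] --> F (toC p).
      by apply: continuous_comp; [exact: ctoC|exact: cF].
    have := H 1 ltr01 => H1.
    exists ([set q | normc (F (toC q) - F (toC p)) < 1], [set M | normc (F (toC p)) + 1 < M]) => /=.
      by split => //; apply: nbhs_pinfty_gt; exact: num_real.
    move=> [q M] /= [H2 H3] _.
    have := ler_normcD (F (toC q) - F (toC p)) (F (toC p)); rewrite subrK; lra.
  (* The square also contains points of norm at least [s], where nothing is known of [F]; near these
     the premise [|z| <= a] fails. *)
  have /(@ccvgP R _ (nbhs p)) H := ctoC p.
  have sa : 0 < s - a by rewrite subr_gt0.
  have H1 := H _ sa.
  exists ([set q | normc (toC q - toC p) < s - a], setT) => /=.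
    by split => //; exact: filterT.
  move=> [q M] [H2 _] qa.
  have := ler_normcB (toC p) (toC q); rewrite normc_distC => H3.
  have {}H2 : normc (toC q - toC p) < s - a := H2.
  have {}qa : normc (toC q) <= a := qa.
  by exfalso; lra.
move=> B [_ HB]; exists (B + 1) => z za.
have := HB (B + 1); rewrite ltrDl ltr01 => /(_ isT (complex.Re z, complex.Im z)).
rewrite /toC /=; case: z za => x y za; apply => //.
by split; rewrite /= in_itv /= -ler_norml; apply: le_trans za;
  [exact: (normRe_le (x +i* y))|exact: (normIm_le (x +i* y))].
Qed.

(** The derivative is complex; its continuity is part of the notion because it occurs as an
    integrand in the proof of Cauchy's formula. *)
Definition C1_hol (S : set C) (f : C -> C) : Prop := exists f' : C -> C,
  forall z : C, S z -> is_derive z 1 f (f' z) /\ {for z, continuous f'}.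

Definition punctured_disc (rho : R) : set C := [set z | 0 < normc z < rho].

Lemma C1_hol_cst S (a : C) : C1_hol S (fun=> a).
Proof.
by exists (fun=> 0) => z _; split; [exact: is_derive_cst|exact: cst_continuous].
Qed.

Lemma C1_hol_id S : C1_hol S id.
Proof.
by exists (fun=> 1) => z _; split; [exact: is_derive_id|exact: cst_continuous].
Qed.

Lemma continuousCD (f g : C -> C) (z : C) : {for z, continuous f} ->
  {for z, continuous g} -> {for z, continuous (fun w => f w + g w)}.
Proof. by move=> cf cg; exact: (cvgD cf cg). Qed.

Lemma continuousCM (f g : C -> C) (z : C) : {for z, continuous f} ->
  {for z, continuous g} -> {for z, continuous (fun w => f w * g w)}.
Proof. by move=> cf cg; exact: (cvgM cf cg). Qed.

Lemma continuousCN (f : C -> C) (z : C) : {for z, continuous f} ->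
  {for z, continuous (fun w => - f w)}.
Proof. by move=> cf; exact: (cvgN cf). Qed.

Lemma continuousCV (f : C -> C) (z : C) : f z != 0 -> {for z, continuous f} ->
  {for z, continuous (fun w => (f w)^-1)}.
Proof. by move=> f0 cf; exact: (cvgV f0 cf). Qed.

Lemma C1_holD S f g : C1_hol S f -> C1_hol S g -> C1_hol S (fun z => f z + g z).
Proof.
move=> [f' fE] [g' gE]; exists (fun z => f' z + g' z) => z Sz.
have [df cf] := fE z Sz; have [dg cg] := gE z Sz.
by split; [exact: is_deriveD|exact: continuousCD].
Qed.

Lemma C1_holM S f g : C1_hol S f -> C1_hol S g -> C1_hol S (fun z => f z * g z).
Proof.
move=> [f' fE] [g' gE]; exists (fun z => f z * g' z + g z * f' z) => z Sz.
have [df cf] := fE z Sz; have [dg cg] := gE z Sz.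
split; first exact: is_deriveM.
have cfz := is_derive_continuous df; have cgz := is_derive_continuous dg.
exact: continuousCD (continuousCM cfz cg) (continuousCM cgz cf).
Qed.

Lemma C1_holX S f n : C1_hol S f -> C1_hol S (fun z => f z ^+ n).
Proof.
move=> Sf; elim: n => [|n IH]; first exact: C1_hol_cst.
by under eq_fun do rewrite exprS; exact: C1_holM.
Qed.

Lemma C1_holV (S : set C) (f : C -> C) : (forall z, S z -> f z != 0) -> C1_hol S f ->
  C1_hol S (fun z => (f z)^-1).
Proof.
move=> f0 [f' fE]; exists (fun z => - ((f z)^-1 * (f z)^-1 * f' z)) => z Sz.
have [df cf] := fE z Sz; split.
  case: (df) => dfz E; split; first exact: (derivableV (f0 z Sz) dfz).
  by rewrite (deriveV (f0 z Sz) dfz) E scaleNr expr2 invfM.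
have cfz := is_derive_continuous df.
have cfV := continuousCV (f0 z Sz) cfz.
exact: continuousCN (continuousCM (continuousCM cfV cfV) cf).
Qed.

Lemma is_derive_shiftC (f : C -> C) (a z d : C) :
  is_derive (a + z) 1 f d -> is_derive z 1 (fun h => f (a + h)) d.
Proof.
move=> /is_deriveP fd; apply/is_deriveP.
by under eq_fun do rewrite addrCA.
Qed.

Lemma continuous_shiftC (f : C -> C) (a z : C) :
  {for a + z, continuous f} -> {for z, continuous (fun h => f (a + h))}.
Proof.
move=> cf; have cz : {for z, continuous (fun w : C => a + w)}.
  by have := continuousCD (@cst_continuous _ _ a z) (fun P (H : nbhs z P) => H).
exact: (continuous_comp cz cf).
Qed.

(** Taylor expansion around [z] on the circle of radius [r = |z| / 2], inside the punctured disc
    because [|z| < rho / 2]; the bound [2 M / r] on the first coefficient is [4 M / |z|]. *)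
Lemma cauchy_estimate (f f' : C -> C) (rho M : R) :
  (forall z : C, punctured_disc rho z -> is_derive z 1 f (f' z) /\ {for z, continuous f'}) ->
  (forall z : C, punctured_disc rho z -> normc (f z) <= M) ->
  forall z : C, 0 < normc z < rho / 2 -> normc (f' z) <= 4 * M / normc z.
Proof.
move=> df fM z /andP[z0 zr].
pose s := normc z * (3 / 4); pose r := normc z / 2.
have r0 : 0 < r by rewrite divr_gt0.
have rs : r < s by rewrite /r /s; lra.
have dom h : normc h < normc z -> punctured_disc rho (z + h).
  move=> hz; rewrite /punctured_disc /=; have := ler_normcD z h.
  have := ler_normcB z (- h); rewrite opprK normcN => ? ?.
  by apply/andP; split; lra.
have dom' h : normc h < s -> punctured_disc rho (z + h).
  by move=> hs; apply: dom; rewrite /s in hs; lra.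
have shiftcont h : normc h < normc z -> {for h, continuous (fun w => f' (z + w))}.
  by move=> /dom /df[_ cf']; exact: continuous_shiftC cf'.
have [||B HB] := @bounded_on_disc (fun w => f' (z + w)) s (normc z).
- by rewrite /s; lra.
- exact: shiftcont.
have [||||c cM tay] := @taylor R (fun h => f (z + h)) (fun h => f' (z + h)) s r B M r0 rs.
- by move=> h /dom' /df[d _]; exact: is_derive_shiftC.
- by move=> h hs; apply: shiftcont; rewrite /s in hs; lra.
- by move=> h /ltW; exact: HB.
- by move=> h hr; apply/fM/dom'; rewrite hr.
have c0 : c 0%N = f z.
  have := tay 0 1; rewrite normc0 => /(_ (ltW _)); rewrite divr_gt0// mul0r expr1 mulr0.
  rewrite big_ord1 expr0 mulr1 addr0 => /(_ isT) H; apply/esym/eqP.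
  by rewrite -subr_eq0 -normc_eq0 eq_le H normc_ge0.
(* The remainder of order 2 shows that [c 1] is a derivative of [f] at [z], and derivatives are
   unique. *)
suff -> : f' z = c 1%N.
  apply: le_trans (cM 1%N) _; rewrite expr1 /r.
  by rewrite le_eqVlt; apply/orP; left; apply/eqP; field; rewrite gt_eqF.
have zdom : punctured_disc rho z by have := dom 0; rewrite normc0 addr0; apply.
have [d _] := df z zdom.
suff d1 : is_derive z 1 f (c 1%N) by rewrite -(@derive_val _ _ _ _ _ _ _ d) (@derive_val _ _ _ _ _ _ _ d1).
apply/is_deriveP/ccvgP => e e0.
have M0 : 0 <= M by apply: le_trans (fM z zdom); exact: normc_ge0.
pose K := 4 * M / r ^+ 2 + 1.
have K0 : 0 < K.
  have : 0 <= 4 * M / r ^+ 2 by rewrite mulr_ge0 ?invr_ge0 ?exprn_ge0 ?(ltW r0)//; lra.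
  by rewrite /K; lra.
apply/dnbhs_normcP; exists (Num.min (r / 2) (e / K)).
  by rewrite lt_min !divr_gt0.
move=> h; rewrite subr0 lt_min => /andP[hr he] h0.
have := tay h 2 (ltW hr); rewrite 2!big_ord_recl big_ord0 /= c0 expr0 mulr1 addr0 => H.
have -> : h^-1 *: (f (h *: 1 + z) - f z) - c 1%N = h^-1 * (f (z + h) - (f z + c 1%N * h ^+ 1)).
  by rewrite [_ *: _]mulrC [h *: 1]mulr1 [h + z]addrC; field.
have nh0 : 0 < normc h by rewrite normc_gt0.
rewrite normcM normcV mulrC ltr_pdivrMr//; apply: le_lt_trans H _.
rewrite (_ : _ * _ ^+ 2 = 4 * M / r ^+ 2 * normc h * normc h); last first.
  by field; rewrite gt_eqF.
rewrite ltr_pM2r//; move: he; rewrite ltr_pdivlMr// /K => he.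
by apply: le_lt_trans he; rewrite mulrDr mulr1 mulrC lerDl normc_ge0.
Qed.

End Punctured.

(** * Order of zeros and expansion at a pole *)

Section Poles.
Variable R : realType.
Local Notation C := (R[i]).
Local Notation normc := (@normc R).
Local Open Scope complex_scope.

Lemma punctured_disc_real (rho r : R) : 0 < r < rho -> punctured_disc rho r%:C.
Proof. by move=> /andP[r0 rr]; rewrite /punctured_disc /mkset normc_real gtr0_norm// r0. Qed.

Lemma sqr_mul_derive (f f' : C -> C) (z : C) :
  is_derive z 1 f (f' z) ->
  is_derive z 1 (fun w => w ^+ 2 * f w) (z * (2 * f z + z * f' z)).
Proof.
move=> df.
have d2 : is_derive z 1 (fun w : C => w ^+ 2) (2 * z).
  have := @is_deriveX _ _ id 2 z 1 1 (is_derive_id z 1).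
  by rewrite expr1 [_ *: _]mulr1.
apply: (is_derive_eq (is_deriveM d2 df)).
by rewrite /GRing.scale /=; ring.
Qed.

(* By Cauchy's estimate f' = O(1/|z|), so z^2 f is C^1 at 0 with derivative 0,
   whatever the junk value f(0). *)
Lemma bounded_taylor (f : C -> C) (rho M : R) : 0 < rho -> C1_hol (punctured_disc rho) f ->
  (forall z : C, punctured_disc rho z -> normc (f z) <= M) ->
  exists (c : nat -> C) (K : R), 0 <= K /\
    forall (z : C) N, 0 < normc z <= rho / 8 ->
      normc (z ^+ 2 * f z - \sum_(n < N) c n * z ^+ n) <= K * (normc z / (rho / 4)) ^+ N.
Proof.
move=> rho0 [f' fE] fM.
have M0 : 0 <= M.
  apply: le_trans (normc_ge0 (f (rho / 2)%:C)) (fM _ _).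
  by apply: punctured_disc_real; apply/andP; split; lra.
pose s := rho / 3; pose r := rho / 4.
have est := cauchy_estimate fE fM.
pose g z : C := z ^+ 2 * f z.
pose g' z : C := z * (2 * f z + z * f' z).
have zdom (z : C) : normc z < s -> z != 0 -> 0 < normc z < rho / 2.
  by rewrite -normc_gt0 /s => zs ->; lra.
have pdom (z : C) : normc z < s -> z != 0 -> punctured_disc rho z.
  by rewrite -normc_gt0 /s /punctured_disc /mkset => zs ->; lra.
(* The factor [2 f + z f'] is at most [2 M + 4 M], the second part by Cauchy's estimate. *)
have g'le (z : C) : normc z < s -> normc (g' z) <= 6 * M * normc z.
  move=> zs; have [->|z0] := eqVneq z 0; first by rewrite /g' mul0r !normc0 mulr0.
  have := est z (zdom z zs z0); have := fM z (pdom z zs z0) => fz.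
  have nz : 0 < normc z by rewrite normc_gt0.
  rewrite ler_pdivlMr// => fz'.
  rewrite /g' normcM mulrC ler_pM2r//; apply: le_trans (ler_normcD _ _) _.
  rewrite !normcM (_ : normc 2 = 2); last first.
    by rewrite -[2]/(1 + 1)  (_ : (1 + 1 : C) = (2 : R)%:C) ?normc_real ?ger0_norm// rmorphD rmorph1.
  by rewrite [normc z * _]mulrC; lra.
have dg (z : C) : normc z < s -> is_derive z 1 g (g' z).
  move=> zs; have [->|z0] := eqVneq z 0; last first.
    by apply: sqr_mul_derive; have [] := fE z (pdom z zs z0).
  rewrite /g' mul0r; apply/is_deriveP/ccvgP => e e0.
  have M1 : 0 < M + 1 by lra.
  apply/dnbhs_normcP; exists (Num.min s (e / (M + 1))).
    by rewrite lt_min !divr_gt0.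
  move=> h; rewrite subr0 lt_min => /andP[hs he] h0.
  rewrite addr0 [h *: 1]mulr1 /g expr0n /= mul0r !subr0 [_ *: _]mulrA expr2 mulKf//.
  rewrite normcM; move: he; rewrite ltr_pdivlMr//; apply: le_lt_trans.
  by rewrite ler_wpM2l ?normc_ge0// (le_trans (fM h (pdom h hs h0)))// lerDl.
have cg' (z : C) : normc z < s -> {for z, continuous g'}.
  move=> zs; have [->|z0] := eqVneq z 0.
    apply/(@ccvgP R _ (nbhs (0 : C))) => e e0.
    have M1 : 0 < 6 * M + 1 by lra.
    apply/nbhs_normcP; exists (Num.min s (e / (6 * M + 1))).
      by rewrite lt_min !divr_gt0.
    move=> h; rewrite subr0 lt_min => /andP[hs he].
    rewrite {2}/g' mul0r subr0; apply: le_lt_trans (g'le h hs) _.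
    move: he; rewrite ltr_pdivlMr//; apply: le_lt_trans.
    by rewrite mulrC ler_wpM2l ?normc_ge0// lerDl.
  have [df cf'] := fE z (pdom z zs z0).
  have cf := is_derive_continuous df.
  have cid : {for z, continuous (id : C -> C)} by move=> P.
  have c2 : {for z, continuous (fun w : C => 2 * f w)}.
    by apply: continuousCM cf; exact: cst_continuous.
  exact: (@continuousCM _ id _ z cid (continuousCD c2 (@continuousCM _ id f' z cid cf'))).
have [||||c _ tay] := @taylor R g g' s r (6 * M * s) (r ^+ 2 * M) _ _ dg cg'.
- by rewrite divr_gt0.
- by rewrite /r /s; lra.
- by move=> z zs; apply: le_trans (g'le z zs) _; rewrite ler_wpM2l ?(ltW zs)//; lra.
- move=> z zr; rewrite /g normcM normcX zr ler_wpM2l ?exprn_ge0 ?divr_ge0 ?(ltW rho0)//.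
  by apply: fM; rewrite /punctured_disc /mkset zr /r; lra.
exists c, (4 * (r ^+ 2 * M)); split.
  by rewrite !mulr_ge0 ?exprn_ge0 ?divr_ge0 ?(ltW rho0).
move=> z N /andP[_ zr]; apply: tay.
by rewrite /r; lra.
Qed.

Lemma near_geometric_lt (L e : R) : 0 < e -> \forall N \near \oo, L * 2^-1 ^+ N < e.
Proof.
move=> e0; have : (L * 2^-1 ^+ N) @[N --> \oo] --> L * 0.
  apply: (@cvgMl_tmp R); apply: cvg_expr.
  by rewrite ger0_norm ?invr_ge0// invf_lt1// ltr1n.
by rewrite mulr0 => /cvgr_lt; exact.
Qed.

(** Were all Taylor coefficients of [z^2 f] zero, the remainder bound would make [f] vanish;
    otherwise the first nonzero term dominates near 0. The exponent [m] still counts the factor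
    [z^2], which is harmless for [|z| < 1]. *)
Lemma order_lower_bound (f : C -> C) (rho M : R) : 0 < rho -> C1_hol (punctured_disc rho) f ->
  (forall z : C, punctured_disc rho z -> normc (f z) <= M) ->
  (forall z : C, punctured_disc rho z -> f z != 0) ->
  exists (m : nat) (r K : R), [/\ 0 < r, r <= rho &
    forall z : C, punctured_disc r z -> normc z ^+ m <= K * normc (f z)].
Proof.
move=> rho0 fh fM f0; have [c [K [K0 tay]]] := bounded_taylor rho0 fh fM.
pose r0 := rho / 4; have r00 : 0 < r0 by rewrite divr_gt0.
have [/existsNP[n0 cn0]|c0] := pselect (~ forall n, c n = 0); last first.
  have {}c0 : forall n, c n = 0 by apply: contrapT.
  pose z : C := (rho / 8)%:C.
  have nz : normc z = rho / 8 by rewrite normc_real ger0_norm ?divr_ge0 ?ltW.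
  have zd : punctured_disc rho z by apply: punctured_disc_real; lra.
  have fz0 : 0 < normc (z ^+ 2 * f z).
    by rewrite normc_gt0 mulf_neq0 ?f0// expf_neq0// -normc_gt0 nz divr_gt0.
  exfalso; suff : \forall N \near \oo, False by move=> [N _ /(_ N (leqnn N))].
  apply: filterS (near_geometric_lt K fz0) => N.
  rewrite ltNge => /negP; apply.
  have := tay z N; rewrite nz lexx divr_gt0// => /(_ isT).
  rewrite big1 ?subr0 => [H|n _]; last by rewrite c0 mul0r.
  by apply: le_trans H _; rewrite (_ : rho / 8 / _ = 2^-1)//; field; rewrite gt_eqF.
have ex : exists n, c n != 0 by exists n0; apply/eqP.
pose m := ex_minn ex.
have [cm cmin] : c m != 0 /\ forall n, (n < m)%N -> c n = 0.
  rewrite /m; case: ex_minnP => k ck kmin; split => // n nk.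
  by apply/eqP; apply: contraTT nk => /kmin; rewrite -leqNgt.
have ncm : 0 < normc (c m) by rewrite normc_gt0.
pose K1 := K + 1; have K10 : 0 < K1 by rewrite /K1; lra.
(* The last bound makes the remainder [K1 (|z| / r0)^(m+1)] at most half of [|c m| |z|^m]; [K1]
   replaces [K], which may be 0, as a divisor. *)
pose r := Num.min (Num.min 1 (rho / 8)) (normc (c m) * r0 ^+ m.+1 / (2 * K1)).
have r_gt0 : 0 < r.
  by rewrite !lt_min ltr01 divr_gt0//= divr_gt0 ?mulr_gt0 ?exprn_gt0.
exists m, r, (2 / normc (c m)); split => //.
  by rewrite /r !ge_min; apply/orP; left; apply/orP; right; lra.
move=> z /andP[z0]; rewrite /r !lt_min => /andP[/andP[z1 zr] zc].
have := tay z m.+1; rewrite z0 (ltW zr) => /(_ isT).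
rewrite big_ord_recr /= big1 ?add0r => [H|n _]; last by rewrite cmin ?mul0r.
have := ler_normcB (c m * z ^+ m) (c m * z ^+ m - z ^+ 2 * f z).
rewrite opprB addrCA subrr addr0 normc_distC => H2.
have {H H2} H : normc (c m) * normc z ^+ m - K1 * (normc z / r0) ^+ m.+1 <=
    normc (z ^+ 2 * f z).
  rewrite -normcX -normcM; apply: le_trans H2.
  rewrite lerD2l lerN2; apply: le_trans H _.
  by rewrite /K1 mulrDl lerDl mul1r exprn_ge0// divr_ge0 ?ltW.
have H2 : K1 * (normc z / r0) ^+ m.+1 <= normc (c m) / 2 * normc z ^+ m.
  rewrite expr_div_n [normc z ^+ m.+1]exprS.
  rewrite (_ : K1 * _ = K1 * normc z / r0 ^+ m.+1 * normc z ^+ m); last by ring.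
  rewrite ler_pM2r ?exprn_gt0// ler_pdivrMr ?exprn_gt0//.
  by move: zc; rewrite ltr_pdivlMr ?mulr_gt0// => /ltW zc; lra.
have H3 : normc (z ^+ 2 * f z) <= normc (f z).
  rewrite normcM normcX ler_piMl ?normc_ge0//.
  by rewrite expr_le1 ?normc_ge0// ltW.
rewrite mulrAC ler_pdivlMr//.
have {zc} : 0 <= normc z ^+ m by rewrite exprn_ge0 ?normc_ge0.
lra.
Qed.

(** [bounded_taylor] applies to the bounded function [z^m g]; its own factor [z^2] is the origin of
    [m.+2]. *)
Lemma pole_expansion (g : C -> C) (rho K : R) (m : nat) : 0 < rho -> C1_hol (punctured_disc rho) g ->
  (forall z : C, punctured_disc rho z -> normc z ^+ m * normc (g z) <= K) ->
  exists c : nat -> C, forall z : C, punctured_disc (rho / 8) z ->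
    series (fun n => c n * z ^+ n) @ \oo --> z ^+ m.+2 * g z.
Proof.
move=> rho0 gh gK.
have [||c [L [L0 tay]]] := @bounded_taylor (fun z => z ^+ m * g z) rho K rho0.
- by apply: C1_holM => //; apply: C1_holX; exact: C1_hol_id.
- by move=> z zd; rewrite normcM normcX gK.
exists c => z /andP[z0 zr].
apply/ccvgP => e e0.
apply: filterS (near_geometric_lt L e0) => N; apply: le_lt_trans.
have := tay z N; rewrite z0 ltW// => /(_ isT).
rewrite mulrA -exprD normc_distC /series /= big_mkord => H; apply: le_trans H _.
rewrite ler_wpM2l// lerXn2r ?nnegrE ?divr_ge0 ?invr_ge0 ?(ltW z0) ?(ltW rho0)//.
by rewrite ler_pdivrMr ?divr_gt0//; lra.
Qed.

End Poles.

(** * Stem functions *)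

Section StemHolomorphy.
Variable R : realType.
Local Notation C := (R[i]).
Local Notation plane := (cd R 1).
Local Notation normc := (@normc R).
Local Open Scope complex_scope.

Lemma mean_value_bound (g g' : R -> R) (a e h : R) :
  (forall t : R, `|t| <= `|h| -> is_derive t 1 g (g' t) /\ `|g' t - a| <= e) ->
  `|g h - g 0 - a * h| <= e * `|h|.
Proof.
move=> gE.
have aux (x y : R) : x < y -> (forall t : R, x <= t <= y -> `|t| <= `|h|) ->
    `|g y - g x - a * (y - x)| <= e * `|y - x|.
  move=> xy xyh.
  have dg (t : R) : t \in `]x, y[ -> is_derive t 1 g (g' t).
    by rewrite in_itv /= => /andP[/ltW xt /ltW ty]; apply: (gE t (xyh t _)).1; rewrite xt.
  have cg : {within `[x, y], continuous g}.
    apply: derivable_within_continuous => t; rewrite in_itv /= => /xyh /gE[[? _] _].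
    by [].
  have [t] := MVT xy dg cg; rewrite in_itv /= => /andP[/ltW xt /ltW ty] ->.
  rewrite -mulrBl normrM ler_wpM2r//; apply: (gE t (xyh t _)).2.
  by rewrite xt.
have [->|h0] := eqVneq h 0; first by rewrite subrr mulr0 subrr normr0 mulr0.
have [hp|hn] := ltrP 0 h.
  have := aux 0 h hp; rewrite subr0; apply => t /andP[t0 th].
  by rewrite !ger0_norm// ltW.
have {hn h0}hn : h < 0 by rewrite lt_neqAle h0.
have := aux h 0 hn; rewrite sub0r normrN mulrN opprK => H.
rewrite -normrN (_ : - (g h - g 0 - a * h) = g 0 - g h + a * h); last by ring.
apply: H => t /andP[th t0]; rewrite !ler0_norm ?(ltW hn)// lerN2//.
Qed.

Lemma nbhs_planeP (z : plane) (P : set plane) : nbhs z P <->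
  exists2 d : R, 0 < d & forall s t : R, `|s| < d -> `|t| < d -> P (z + (s, t)).
Proof.
split=> [/(@nbhs_ballP R (R^o * R^o)%type)[d /= d0 H]|[d d0 H]].
  exists d => // s t sd td; apply: H.
  rewrite -(@ball_normE R (R^o * R^o)%type) /ball_ /= opprD addrA subrr sub0r normrN.
  by rewrite prod_normE /= gt_max sd td.
apply/(@nbhs_ballP R (R^o * R^o)%type); exists d => //= w.
rewrite -(@ball_normE R (R^o * R^o)%type) /ball_ /= distrC prod_normE /= gt_max => /andP[h1 h2].
by have := H _ _ h1 h2; rewrite -[(_, _)]/(w - z) addrC subrK.
Qed.

(** The increment follows two sides of a rectangle, from [z] to [z + (0, h2)] and on to
    [z + (h1, h2)], with the mean value bound on each. *)
Lemma total_differential (u A B : plane -> R) (z : plane) :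
  (\forall p \near z, is_derive p ((1, 0) : plane) (u : plane -> R^o) (A p) /\
     is_derive p ((0, 1) : plane) (u : plane -> R^o) (B p)) ->
  {for z, continuous A} -> {for z, continuous B} ->
  forall e : R, 0 < e -> exists2 d : R, 0 < d &
    forall h1 h2 : R, `|h1| < d -> `|h2| < d ->
      `|u (z + (h1, h2)) - u z - (A z * h1 + B z * h2)| <= e * (`|h1| + `|h2|).
Proof.
move=> du /cvgrPdist_le cA /cvgrPdist_le cB e e0.
have [d d0 Hd] := (nbhs_planeP z _).1 (filterI (filterI (cA e e0) (cB e e0)) du).
exists d => // h1 h2 h1d h2d.
have inball (s t : R) : `|s| <= `|h1| -> `|t| <= `|h2| ->
    (`|A z - A (z + (s, t))| <= e /\ `|B z - B (z + (s, t))| <= e) /\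
    is_derive (z + (s, t)) ((1, 0) : plane) (u : plane -> R^o) (A (z + (s, t))) /\
    is_derive (z + (s, t)) ((0, 1) : plane) (u : plane -> R^o) (B (z + (s, t))).
  by move=> sh th; exact: Hd (le_lt_trans sh h1d) (le_lt_trans th h2d).
pose g1 t := u (z + (t, h2)); pose g2 t := u (z + (0, t)).
have b1 : `|g1 h1 - g1 0 - A z * h1| <= e * `|h1|.
  apply: (@mean_value_bound g1 (fun t => A (z + (t, h2)))) => t th.
  have [[At _] [d1 _]] := inball t h2 th (lexx _).
  split; last by rewrite distrC.
  apply/is_deriveP; move/is_deriveP: d1.
  rewrite /g1; under eq_fun => h.
    rewrite (_ : h *: (1, 0) + (z + (t, h2)) = z + (h *: 1 + t, h2)); last first.
      by case: z {cA cB du Hd inball g1 g2 At} => x y; congr pair => /=;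
        rewrite /GRing.scale /=; ring.
    over.
  by [].
have b2 : `|g2 h2 - g2 0 - B z * h2| <= e * `|h2|.
  apply: (@mean_value_bound g2 (fun t => B (z + (0, t)))) => t th.
  have [|[_ Bt] [_ d2]] := inball 0 t _ th; first by rewrite normr0.
  split; last by rewrite distrC.
  apply/is_deriveP; move/is_deriveP: d2.
  rewrite /g2; under eq_fun => h.
    rewrite (_ : h *: (0, 1) + (z + (0, t)) = z + (0, h *: 1 + t)); last first.
      by case: z {cA cB du Hd inball g1 g2 b1 Bt} => x y; congr pair => /=;
        rewrite /GRing.scale /=; ring.
    over.
  by [].
have g120 : g1 0 = g2 h2 by [].
have g20 : g2 0 = u z by rewrite /g2 (_ : (0, 0) = 0 :> plane)// addr0.
rewrite -[u (z + _)]/(g1 h1) -g20.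
rewrite (_ : _ - _ - _ = (g1 h1 - g1 0 - A z * h1) + (g2 h2 - g2 0 - B z * h2)).
  by apply: le_trans (ler_normD _ _) _; rewrite mulrDr lerD.
by rewrite g120; ring.
Qed.

Definition plane_of (w : C) : plane := (complex.Re w, complex.Im w).

(** [A] and [B] are the partial derivatives of [F1]; the Cauchy-Riemann equations prescribe those of
    [F2], and [A - i B] is the complex derivative of [F1 + i F2]. *)
Definition stem_cauchy_riemann k (F1 F2 A B : plane -> cd R k) (z : plane) : Prop :=
  [/\ is_derive z ((1, 0) : plane) F1 (A z), is_derive z ((0, 1) : plane) F1 (B z),
      is_derive z ((1, 0) : plane) F2 (- B z) & is_derive z ((0, 1) : plane) F2 (A z)] /\
  {for z, continuous A} /\ {for z, continuous B}.

(** Holomorphy of [G1 + i G2] in the complexification of [A], unfolded to real coordinates: each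
    coordinate pair is one scalar holomorphic function. *)
Fixpoint C1_hol_stem k (S : set C) : (C -> cd R k) -> (C -> cd R k) -> Prop :=
  match k return (C -> cd R k) -> (C -> cd R k) -> Prop with
  | 0 => fun G1 G2 : C -> R => C1_hol S (fun w => G1 w +i* G2 w)
  | k'.+1 => fun G1 G2 : C -> cd R k' * cd R k' =>
      C1_hol_stem S (fun w => (G1 w).1) (fun w => (G2 w).1) /\
      C1_hol_stem S (fun w => (G1 w).2) (fun w => (G2 w).2)
  end.

Lemma continuous_plane_of (z0 : plane) (w : C) (V : topologicalType) (A : plane -> V) :
  {for z0 + plane_of w, continuous A} -> {for w, continuous (fun w => A (z0 + plane_of w))}.
Proof.
move=> cA; have cp : {for w, continuous (fun w => z0 + plane_of w)}.
  apply/(@cvgrPdist_lt R (R^o * R^o)%type C (nbhs w)) => e e0.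
  apply/nbhs_normcP; exists e => // v vw.
  rewrite opprD addrACA subrr add0r prod_normE /= gt_max.
  apply/andP; split.
    by rewrite -raddfB; apply: le_lt_trans (normRe_le _) _; rewrite normc_distC.
  by rewrite -raddfB; apply: le_lt_trans (normIm_le _) _; rewrite normc_distC.
exact: (continuous_comp cp cA).
Qed.

Lemma cauchy_riemann_is_derive (F1 F2 A B : plane -> R) (z0 : plane) (w : C) :
  (\forall z \near z0 + plane_of w, @stem_cauchy_riemann 0 F1 F2 A B z) ->
  is_derive w 1 (fun w => F1 (z0 + plane_of w) +i* F2 (z0 + plane_of w))
    (A (z0 + plane_of w) +i* - B (z0 + plane_of w)).
Proof.
set z := z0 + plane_of w => CR; have [_ [cA cB]] := nbhs_singleton CR.
apply/is_deriveP/ccvgP => e e0.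
(* Two errors of at most [e / 8 (|x| + |y|) <= e / 4 |h|] each leave a strict margin below
   [e |h|]. *)
have e4 : 0 < e / 8 by rewrite divr_gt0.
have [|d1 d10 H1] := @total_differential F1 A B z _ cA cB _ e4.
  by apply: filterS CR => p [[? ? _ _] _].
have cNB : {for z, continuous (fun p => - B p)} by exact: (cvgN cB).
have [|d2 d20 H2] := @total_differential F2 (fun p => - B p) A z _ cNB cA _ e4.
  by apply: filterS CR => p [[_ _ ? ?] _].
apply/dnbhs_normcP; exists (Num.min d1 d2); first by rewrite lt_min d10.
move=> h; rewrite subr0 lt_min => /andP[hd1 hd2] h0.
have nh0 : 0 < normc h by rewrite normc_gt0.
rewrite [h *: 1]mulr1 (_ : z0 + plane_of (h + w) = z + (complex.Re h, complex.Im h)); last first.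
  rewrite /z -addrA; congr (_ + _); rewrite /plane_of !raddfD /= [RHS]addrC.
  by [].
set d := _ +i* - _; set f1 := _ +i* _; set f0 := _ +i* _.
rewrite (_ : h^-1 *: _ - d = h^-1 * (f1 - f0 - d * h)); last by rewrite [_ *: _]mulrC; field.
rewrite normcM normcV mulrC ltr_pdivrMr//.
apply: le_lt_trans (normc_le_ReIm _) _.
have hr := normRe_le h; have hi := normIm_le h.
have := H1 _ _ (le_lt_trans hr hd1) (le_lt_trans hi hd1).
have := H2 _ _ (le_lt_trans hr hd2) (le_lt_trans hi hd2).
rewrite /d /f1 /f0 {d f1 f0}; case: h h0 hd1 hd2 nh0 hr hi => x y h0 hd1 hd2 nh0 hr hi.
rewrite /complex.Re /complex.Im => K2 K1.
set m1 := `|_|; set m2 := `|_|.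
have -> : m1 = `|F1 (z + (x, y)) - F1 z - (A z * x + B z * y)|.
  by congr (`|_|); rewrite /=; ring.
have -> : m2 = `|F2 (z + (x, y)) - F2 z - (- B z * x + A z * y)|.
  by congr (`|_|); rewrite /=; ring.
apply: le_lt_trans (lerD K1 K2) _.
have : e / 8 * (`|x| + `|y|) <= e / 8 * (2 * normc (x +i* y)).
  by rewrite ler_wpM2l ?(ltW e4)//; move: hr hi; rewrite /complex.Re /complex.Im; lra.
have : 0 < e * normc (x +i* y) by rewrite mulr_gt0.
lra.
Qed.

Lemma is_derive_component (V W1 W2 : normedModType R) (F : V -> W1 * W2) (z v : V)
    (d : W1 * W2) : is_derive z v F d ->
  is_derive z v (fun p => (F p).1) d.1 /\ is_derive z v (fun p => (F p).2) d.2.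
Proof.
move=> /is_deriveP Fd; split; apply/is_deriveP.
- have c1 : q.1 @[q --> d] --> d.1 by exact: cvg_fst.
  exact: (cvg_comp _ _ Fd c1).
- have c2 : q.2 @[q --> d] --> d.2 by exact: cvg_snd.
  exact: (cvg_comp _ _ Fd c2).
Qed.

Lemma continuous_component (T V W : topologicalType) (F : T -> V * W) (z : T) :
  {for z, continuous F} ->
  {for z, continuous (fun p => (F p).1)} /\ {for z, continuous (fun p => (F p).2)}.
Proof.
move=> cF; split.
- have c1 : q.1 @[q --> F z] --> (F z).1 by exact: cvg_fst.
  exact: (cvg_comp _ _ cF c1).
- have c2 : q.2 @[q --> F z] --> (F z).2 by exact: cvg_snd.
  exact: (cvg_comp _ _ cF c2).
Qed.

Lemma stem_C1_hol k (D : set plane) (S : set C) (F1 F2 A B : plane -> cd R k) (z0 : plane) :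
  open D -> (forall z, D z -> stem_cauchy_riemann F1 F2 A B z) ->
  (forall w, S w -> D (z0 + plane_of w)) ->
  C1_hol_stem S (fun w => F1 (z0 + plane_of w)) (fun w => F2 (z0 + plane_of w)).
Proof.
move=> oD; elim: k F1 F2 A B => [|k IH] F1 F2 A B CR SD.
  exists (fun w => A (z0 + plane_of w) +i* - B (z0 + plane_of w)) => w Sw; split.
    apply: cauchy_riemann_is_derive.
    by apply: filterS (open_nbhs_nbhs (conj oD (SD w Sw))) => z /CR.
  have [_ [cA cB]] := CR _ (SD w Sw).
  have := continuous_plane_of cA; have := continuous_plane_of cB => cB' cA'.
  exact: (cvg_complex cA' (cvgN cB')).
split.
- apply: (IH (fun p => (F1 p).1) (fun p => (F2 p).1) (fun p => (A p).1) (fun p => (B p).1)) => // z /CR[[d1 d2 d3 d4] [cA cB]].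
  split; first by split; [exact: (is_derive_component d1).1|exact: (is_derive_component d2).1
    |exact: (is_derive_component d3).1|exact: (is_derive_component d4).1].
  by split; [exact: (continuous_component cA).1|exact: (continuous_component cB).1].
- apply: (IH (fun p => (F1 p).2) (fun p => (F2 p).2) (fun p => (A p).2) (fun p => (B p).2)) => // z /CR[[d1 d2 d3 d4] [cA cB]].
  split; first by split; [exact: (is_derive_component d1).2|exact: (is_derive_component d2).2
    |exact: (is_derive_component d3).2|exact: (is_derive_component d4).2].
  by split; [exact: (continuous_component cA).2|exact: (continuous_component cB).2].
Qed.

End StemHolomorphy.

(** * Growth and expansion of a stem that avoids a value *)

Section StemPoles.
Variable R : realType.
Local Notation C := (R[i]).
Local Notation normc := (@normc R).
Local Open Scope complex_scope.

(* [act1 s a b] and [act2 s a b] are the two components of the product of the complex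
   number s with the element (a, b) = a + i b of the complexification of A. *)
Definition act1 k (s : C) (a b : cd R k) : cd R k := complex.Re s *: a - complex.Im s *: b.
Definition act2 k (s : C) (a b : cd R k) : cd R k := complex.Re s *: b + complex.Im s *: a.

Lemma series_component (V W : normedModType R) (u : nat -> V * W) (l : V * W) :
  series (fun n => (u n).1) @ \oo --> l.1 -> series (fun n => (u n).2) @ \oo --> l.2 ->
  series u @ \oo --> l.
Proof.
move=> u1 u2.
have -> : series u = (fun N => (series (fun n => (u n).1) N, series (fun n => (u n).2) N)).
  apply/funext => N; rewrite /series /=.
  rewrite [LHS]surjective_pairing; congr pair.
  - exact: (big_morph (fun p : V * W => p.1) (fun _ _ => erefl) erefl).
  - exact: (big_morph (fun p : V * W => p.2) (fun _ _ => erefl) erefl).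
by case: l u1 u2 => a b; exact: cvg_pair.
Qed.

(** [pole_expansion] coordinate by coordinate, with common [m] and [K]; a bound on the sum of
    squares passes to both halves of a Cayley-Dickson pair. *)
Lemma stem_expansion k (G1 G2 : C -> cd R k) (rho K : R) (m : nat) : 0 < rho -> 0 <= K ->
  C1_hol_stem (punctured_disc rho) G1 G2 ->
  (forall z, punctured_disc rho z -> (normc z ^+ m) ^+ 2 * (normsq (G1 z) + normsq (G2 z)) <= K ^+ 2) ->
  exists b1 b2 : nat -> cd R k, forall z, punctured_disc (rho / 8) z ->
    series (fun n => act1 (z ^+ n) (b1 n) (b2 n)) @ \oo --> act1 (z ^+ m.+2) (G1 z) (G2 z) /\
    series (fun n => act2 (z ^+ n) (b1 n) (b2 n)) @ \oo --> act2 (z ^+ m.+2) (G1 z) (G2 z).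
Proof.
move=> rho0 K0; elim: k G1 G2 => [|k IH] G1 G2 Gh Gb.
  have [|c cE] := pole_expansion (K := K) (m := m) rho0 Gh.
    move=> z zd; rewrite -(ler_pXn2r (n := 2)) ?nnegrE ?mulr_ge0 ?exprn_ge0 ?normc_ge0//.
    rewrite exprMn [normc (_ +i* _)]/= sqr_sqrtr ?addr_ge0 ?sqr_ge0//.
    exact: Gb.
  exists (fun n => complex.Re (c n)), (fun n => complex.Im (c n)) => z /cE cz.
  have Re_series N : complex.Re (series (fun n => c n * z ^+ n) N) =
      series (fun n => act1 (k := 0) (z ^+ n) (complex.Re (c n)) (complex.Im (c n))) N.
    rewrite /series /= raddf_sum; apply: eq_bigr => n _.
    by case: (c n) (z ^+ n) => a b [e d]; rewrite /act1 /GRing.scale /=; ring.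
  have Im_series N : complex.Im (series (fun n => c n * z ^+ n) N) =
      series (fun n => act2 (k := 0) (z ^+ n) (complex.Re (c n)) (complex.Im (c n))) N.
    rewrite /series /= raddf_sum; apply: eq_bigr => n _.
    by case: (c n) (z ^+ n) => a b [e d]; rewrite /act2 /GRing.scale /=; ring.
  split.
  - rewrite -(funext Re_series).
    rewrite (_ : @act1 0 _ _ _ = complex.Re (z ^+ m.+2 * (G1 z +i* G2 z))); last first.
      by case: (z ^+ m.+2).
    exact: cvg_Re cz.
  - rewrite -(funext Im_series).
    rewrite (_ : @act2 0 _ _ _ = complex.Im (z ^+ m.+2 * (G1 z +i* G2 z))); last first.
      by case: (z ^+ m.+2).
    exact: cvg_Im cz.
case: Gh => Gh1 Gh2.
have nn (z : C) : 0 <= (normc z ^+ m) ^+ 2 by rewrite sqr_ge0.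
have [|b1 [b2 bE]] := IH _ _ Gh1.
  move=> z /Gb; apply: le_trans; rewrite ler_wpM2l//=.
  by have := normsq_ge0 (G1 z).2; have := normsq_ge0 (G2 z).2; lra.
have [|d1 [d2 dE]] := IH _ _ Gh2.
  move=> z /Gb; apply: le_trans; rewrite ler_wpM2l//=.
  by have := normsq_ge0 (G1 z).1; have := normsq_ge0 (G2 z).1; lra.
exists (fun n => (b1 n, d1 n)), (fun n => (b2 n, d2 n)) => z zd.
have [b1z b2z] := bE z zd; have [d1z d2z] := dE z zd.
by split; apply: series_component.
Qed.

(* The complex bilinear extension of [normsq] to the complexification of A. *)
Fixpoint complex_normsq k : cd R k -> cd R k -> C :=
  match k return cd R k -> cd R k -> C with
  | 0 => fun a b : R => (a +i* b) ^+ 2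
  | k'.+1 => fun a b : cd R k' * cd R k' =>
      complex_normsq a.1 b.1 + complex_normsq a.2 b.2
  end.

Lemma complex_normsqE k (a b : cd R k) :
  complex_normsq a b = (normsq a - normsq b) +i* (2 * cddot a b).
Proof.
elim: k a b => [|k IH] a b.
  by rewrite /= !expr2; congr (_ +i* _); ring.
by rewrite /= !IH; congr (_ +i* _) => /=; ring.
Qed.

Lemma C1_hol_complex_normsq k S (G1 G2 : C -> cd R k) : C1_hol_stem S G1 G2 ->
  C1_hol S (fun z => complex_normsq (G1 z) (G2 z)).
Proof.
elim: k G1 G2 => [|k IH] G1 G2 /=; first by move=> Gh; exact: C1_holX.
by move=> [Gh1 Gh2]; apply: C1_holD; exact: IH.
Qed.

Lemma C1_hol_stemB k S (G1 G2 : C -> cd R k) (c : cd R k) : C1_hol_stem S G1 G2 ->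
  C1_hol_stem S (fun z => G1 z - c) G2.
Proof.
elim: k G1 G2 c => [|k IH] G1 G2 c /=; last by move=> [? ?]; split; exact: IH.
move=> Gh; have := C1_holD Gh (C1_hol_cst S (- c)%:C).
congr C1_hol; apply/funext => z.
by rewrite -[LHS]/((_ + _) +i* (_ + _)) addr0.
Qed.

Lemma C1_hol_sub (S S' : set C) f : S' `<=` S -> C1_hol S f -> C1_hol S' f.
Proof. by move=> SS [f' fE]; exists f' => z /SS; exact: fE. Qed.

(** Write [N = |G1|^2 + |G2|^2] and [h] for the complex norm. [slice_norm_bound] gives
    [e^2 N <= |h|^2]; since [|h| <= N], this yields [e^2 |h| <= |h|^2], and [|h|] can be cancelled
    because [h = 0] would force [G1 = G2 = 0]. *)
Lemma stem_lower_bound k (hk : (1 <= k <= 3)%N) (G1 G2 : cd R k) (e : R) : 0 < e ->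
  (forall J, imag_unit J -> e ^+ 2 <= normsq (G1 + cdmul J G2)) ->
  e ^+ 2 * (normsq G1 + normsq G2) <= normc (complex_normsq G1 G2) ^+ 2 /\
  e ^+ 2 <= normc (complex_normsq G1 G2).
Proof.
move=> e0 Ge; have [J SJ HJ] := slice_norm_bound hk G1 G2.
have n1 := normsq_ge0 G1; have n2 := normsq_ge0 G2.
have e2 : 0 < e ^+ 2 by rewrite exprn_gt0.
have H1 : e ^+ 2 * (normsq G1 + normsq G2) <= normc (complex_normsq G1 G2) ^+ 2.
  rewrite complex_normsqE [normc _]/= sqr_sqrtr ?addr_ge0 ?sqr_ge0//.
  by apply: le_trans HJ; rewrite ler_wpM2r ?addr_ge0// Ge.
split => //.
(* [N^2 - |h|^2] is four times the squared norm of the imaginary part of [G1 G2^c]. *)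
have H2 : normc (complex_normsq G1 G2) <= normsq G1 + normsq G2.
  rewrite -(ler_pXn2r (n := 2)) ?nnegrE ?normc_ge0 ?addr_ge0//.
  rewrite complex_normsqE [normc _]/= sqr_sqrtr ?addr_ge0 ?sqr_ge0//.
  have := normsqM hk G1 (cdconj G2); rewrite normsq_conj normsq_reim.
  have -> : cdre (cdmul G1 (cdconj G2)) = cddot G1 G2.
    have := cddot_mul hk (cdreal k 1) G2 G1; rewrite cdmul_reall scale1r.
    by rewrite [RHS]cddotC cddot_real mul1r cddotC => <-.
  by have := normsq_ge0 (cdim (cdmul G1 (cdconj G2))); nra.
have hpos : 0 < normc (complex_normsq G1 G2).
  rewrite lt_def normc_ge0 andbT; apply/eqP => h0.
  have s0 : normsq G1 + normsq G2 = 0.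
    by apply/eqP; rewrite eq_le addr_ge0// andbT -(ler_pM2l e2) mulr0 (le_trans H1)// h0 expr0n.
  have G20 : G2 = 0 by apply: normsq_eq0; lra.
  by have := Ge J SJ; rewrite G20 cdmulx0 addr0; lra.
rewrite -(ler_pM2r hpos); apply: le_trans (le_trans H1 _); last by rewrite expr2.
by rewrite ler_pM2l.
Qed.

Lemma stem_pole k (hk : (1 <= k <= 3)%N) (F1 F2 : C -> cd R k) (c : cd R k) (rho e : R) :
  0 < rho -> 0 < e -> C1_hol_stem (punctured_disc rho) F1 F2 ->
  (forall z J, punctured_disc rho z -> imag_unit J ->
     e ^+ 2 <= normsq (F1 z + cdmul J (F2 z) - c)) ->
  exists (m : nat) (r : R) (b1 b2 : nat -> cd R k), [/\ 0 < r, r <= rho &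
    forall z, punctured_disc r z ->
    series (fun n => act1 (z ^+ n) (b1 n) (b2 n)) @ \oo --> act1 (z ^+ m) (F1 z) (F2 z) /\
    series (fun n => act2 (z ^+ n) (b1 n) (b2 n)) @ \oo --> act2 (z ^+ m) (F1 z) (F2 z)].
Proof.
move=> rho0 e0 Fh Fe.
have e2 : 0 < e ^+ 2 by rewrite exprn_gt0.
pose h z := complex_normsq (F1 z - c) (F2 z).
have hlow z : punctured_disc rho z -> e ^+ 2 * (normsq (F1 z - c) + normsq (F2 z)) <= normc (h z) ^+ 2 /\
    e ^+ 2 <= normc (h z).
  move=> zd; apply: stem_lower_bound => // J SJ.
  by rewrite addrAC; exact: Fe.
have h0 z : punctured_disc rho z -> h z != 0.
  by move=> /hlow[_ hz]; rewrite -normc_gt0 (lt_le_trans e2).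
have [|||m [r [K [r0 rrho mK]]]] := @order_lower_bound R (fun z => (h z)^-1) rho (e ^- 2) rho0.
- by apply: C1_holV => //; apply: C1_hol_complex_normsq; exact: C1_hol_stemB.
- move=> z zd; rewrite normcV lef_pV2 ?posrE ?normc_gt0 ?h0//.
  by have [] := hlow z zd.
- by move=> z zd; rewrite invr_eq0 h0.
(* Within radius 1 the power [|z|^m] is at most 1, so passing from [F1 - c] back to [F1] costs only
   a constant. *)
pose r' := Num.min r 1.
have r'0 : 0 < r' by rewrite lt_min r0 ltr01.
have r'd z : punctured_disc r' z -> [/\ punctured_disc r z, punctured_disc rho z & normc z <= 1].
  rewrite /punctured_disc /mkset /r' lt_min => /andP[-> /andP[zr z1]].
  by rewrite zr (lt_le_trans zr rrho) ltW.
have Kpos : 0 <= K.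
  have rd : punctured_disc r (r / 2)%:C by apply: punctured_disc_real; lra.
  have rhod : punctured_disc rho (r / 2)%:C by apply: punctured_disc_real; lra.
  have := mK _ rd; rewrite normcV => H.
  have H0 := le_trans (exprn_ge0 m (normc_ge0 _)) H.
  by move: H0; rewrite pmulr_lge0// invr_gt0 normc_gt0 h0.
(* From [|F1|^2 <= 2 |F1 - c|^2 + 2 |c|^2], the inequality [|z|^m |h| <= K] and the lower bound on
   [|h|^2]. *)
pose L := 2 * (K ^+ 2 / e ^+ 2) + 2 * normsq c.
have L0 : 0 <= L.
  have : 0 <= K ^+ 2 / e ^+ 2 by rewrite divr_ge0 ?sqr_ge0.
  by have := normsq_ge0 c; rewrite /L; lra.
have Fb z : punctured_disc r' z ->
    (normc z ^+ m) ^+ 2 * (normsq (F1 z) + normsq (F2 z)) <= Num.sqrt L ^+ 2.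
  move=> /r'd[zr zrho z1]; rewrite sqr_sqrtr//.
  have [H1 H2] := hlow z zrho.
  have hz : 0 < normc (h z) by rewrite normc_gt0 h0.
  have Hm : normc z ^+ m * normc (h z) <= K.
    by have := mK z zr; rewrite normcV ler_pdivlMr.
  set t := normc z ^+ m in Hm *.
  have t0 : 0 <= t by rewrite exprn_ge0 ?normc_ge0.
  have t1 : t <= 1 by rewrite exprn_ile1 ?normc_ge0.
  have Hm2 : t ^+ 2 * normc (h z) ^+ 2 <= K ^+ 2.
    by rewrite -exprMn ler_pXn2r ?nnegrE ?mulr_ge0 ?normc_ge0.
  have HG : t ^+ 2 * (normsq (F1 z - c) + normsq (F2 z)) <= K ^+ 2 / e ^+ 2.
    rewrite ler_pdivlMr// -mulrA [_ * e ^+ 2]mulrC; apply: le_trans Hm2.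
    by rewrite ler_wpM2l ?sqr_ge0.
  have HF : normsq (F1 z) <= 2 * normsq (F1 z - c) + 2 * normsq c.
    have := normsq_ge0 (F1 z - c - c); rewrite (normsqD (F1 z - c)) normsqN.
    have := normsqD (F1 z - c) c; rewrite subrK => ->.
    have -> : cddot (F1 z - c) (- c) = - cddot (F1 z - c) c.
      by rewrite cddotC -scaleN1r cddotZl mulN1r cddotC.
    by lra.
  have t2 : t ^+ 2 <= 1 by rewrite exprn_ile1.
  have tt : 0 <= t ^+ 2 by rewrite sqr_ge0.
  have nF2 := normsq_ge0 (F2 z).
  have nc := normsq_ge0 c.
  apply: (@le_trans _ _ (t ^+ 2 * (2 * (normsq (F1 z - c) + normsq (F2 z)) + 2 * normsq c))).
    by rewrite ler_wpM2l//; lra.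
  rewrite mulrDr /L; apply: lerD; first by rewrite mulrCA ler_pM2l.
  by rewrite mulrC ler_piMr// mulr_ge0.
have Fh' : C1_hol_stem (punctured_disc r') F1 F2.
  have sub : punctured_disc r' `<=` punctured_disc rho by move=> z /r'd[].
  elim: (k) F1 F2 Fh {Fe h hlow h0 mK Fb} => [|k' IH] F1 F2 /=; first exact: C1_hol_sub.
  by move=> [? ?]; split; exact: IH.
have [b1 [b2 bE]] := stem_expansion r'0 (sqrtr_ge0 L) Fh' Fb.
exists m.+2, (r' / 8), b1, b2; split => //; first by rewrite divr_gt0.
have r'r : r' <= r by rewrite ge_min lexx.
by lra.
Qed.

End StemPoles.

(** * Slice functions and Laurent terms *)

Section SliceFunctions.
Variables (R : realType) (k : nat).
Hypothesis hk : (1 <= k <= 3)%N.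
Local Notation A := (cd R k).
Local Notation C := (R[i]).
Local Notation plane := (cd R 1).
Local Open Scope complex_scope.

Let k0 : (0 < k)%N. Proof. by case/andP: hk. Qed.

Definition eval_stem (J : A) (F : stem R k) (z : plane) : A := F.1 z + cdmul J (F.2 z).

Definition is_stem (f : A -> A) (F : stem R k) : Prop :=
  stem_on setT F /\ induces setT F f.

Lemma cdmul_unitI (J x y : A) : imag_unit J -> cdmul J x = cdmul J y -> x = y.
Proof.
by move=> SJ E; apply: oppr_inj; rewrite -!(cdmul_unitK hk _ SJ) E.
Qed.

(** The values of [f] at [J] and [- J] determine [F1] as their half sum, and then [J F2]. *)
Lemma is_stem_unique (f : A -> A) (F G : stem R k) : is_stem f F -> is_stem f G -> F = G.
Proof.
move=> [_ fF] [_ fG]; have SJ := imag_unit_basic R k0; set J := basic_unit R k in SJ.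
have E z : F.1 z = G.1 z /\ F.2 z = G.2 z.
  have E1 : F.1 z + cdmul J (F.2 z) = G.1 z + cdmul J (G.2 z) by rewrite -fF// fG.
  have E2 : F.1 z - cdmul J (F.2 z) = G.1 z - cdmul J (G.2 z).
    by rewrite -!cdmulNl -fF ?fG//; exact: imag_unitN.
  have E3 : F.1 z = G.1 z.
    apply: (@scalerI _ _ (2 : R)); first by rewrite pnatr_eq0.
    rewrite !scaler_nat !mulr2n -[LHS]addr0 -(subrr (cdmul J (F.2 z))) addrACA E1 E2.
    by rewrite addrACA subrr addr0.
  split => //; apply: (cdmul_unitI SJ); apply: (addrI (F.1 z)).
  by rewrite E1 E3.
case: F G {fF fG} E => [F1 F2] [G1 G2] E.
by congr pair; apply/funext => z; case: (E z).
Qed.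

Lemma stem_ofE (f : A -> A) (F : stem R k) : is_stem f F -> stem_of f = F.
Proof.
move=> fF; apply: xget_unique => //= G fG.
exact: (is_stem_unique fG fF).
Qed.

(** [slice_fun] reads a point in the closed upper half-plane. Parity of the stem covers [z.2 < 0],
    and for [z.2 = 0] oddness makes [F2] vanish. *)
Lemma is_stem_slice_fun (F : stem R k) : stem_on setT F -> is_stem (slice_fun F) F.
Proof.
move=> HF; split => // z J _ SJ.
rewrite /slice_fun cdre_slice// enorm_cdim_slice// cdim_slice// scalerA.
have [F1 F2] := HF z I; case: z F1 F2 => [a b] /= F1 F2.
have [b0|b0|b0] := ltrgtP b 0.
- by rewrite ltr0_norm// F1 F2 invrN mulNr mulVf ?lt_eqF// scaleN1r cdmulNl cdmulNr opprK.
- by rewrite gtr0_norm// mulVf ?gt_eqF// scale1r.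
- suff F20 : F.2 (a, 0) = 0 by rewrite b0 normr0 F20 !cdmulx0.
  move: F2; rewrite b0 oppr0 => E; apply: (@scalerI _ _ (2 : R)); first by rewrite pnatr_eq0.
  by rewrite scaler0 scaler_nat mulr2n {1}E addNr.
Qed.

Lemma stem_on_prod (F G : stem R k) : stem_on setT F -> stem_on setT G ->
  stem_on setT (stem_prod F G).
Proof.
move=> HF HG z _; have [F1 F2] := HF z I; have [G1 G2] := HG z I.
by rewrite /= F1 F2 G1 G2 !cdmulNl !cdmulNr opprK opprD.
Qed.

Lemma is_stem_prod (f g : A -> A) (F G : stem R k) : is_stem f F -> is_stem g G ->
  is_stem (slice_prod f g) (stem_prod F G).
Proof.
move=> fF gG; rewrite /slice_prod (stem_ofE fF) (stem_ofE gG).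
by apply/is_stem_slice_fun/stem_on_prod; [case: fF|case: gG].
Qed.

Definition stem_cst (a : A) : stem R k := (fun=> a, fun=> 0).

Lemma is_stem_cst (a : A) : is_stem (fun=> a) (stem_cst a).
Proof.
split; first by move=> z _; rewrite /= oppr0.
by move=> z J _ _; rewrite /= cdmulx0 addr0.
Qed.

Definition stem_exp (F : stem R k) n : stem R k := iter n (stem_prod F) (stem_cst (cdreal k 1)).

Lemma is_stem_exp (f : A -> A) (F : stem R k) n : is_stem f F ->
  is_stem (slice_exp f n) (stem_exp F n).
Proof.
move=> fF; elim: n => [|n IH]; first exact: is_stem_cst.
exact: is_stem_prod.
Qed.

Definition stem_sub (y : A) : stem R k :=
  (fun z => cdreal k z.1 - y, fun z => cdreal k z.2).

Lemma is_stem_sub (y : A) : is_stem (fun x => x - y) (stem_sub y).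
Proof.
split; first by move=> z _; rewrite /= cdrealN.
by move=> z J _ _; rewrite /= cdmul_realr addrAC.
Qed.

(* [Delta y] preserves every slice and acts on all of them by the same coordinates. *)
Definition Delta_coord (y : A) (z : plane) : plane :=
  ((2 * z.1 - 2 * cdre y) * z.1 + (normsq y - normsq z),
   (2 * z.1 - 2 * cdre y) * z.2).

Lemma Delta_slice (y J : A) (z : plane) : imag_unit J ->
  Delta y (slice_point z J) = slice_point (Delta_coord y z) J.
Proof.
move=> SJ; rewrite /Delta cdsqrE cdtraceE cdmul_realr cdnormE normsq_slice// cdre_slice//.
rewrite /Delta_coord; set N := normsq z.
rewrite [X in X + _]addrAC -scalerBl -addrA [- _ + _]addrC /slice_point /=.
by rewrite [in RHS]cdrealD cdrealD cdrealN cdrealZ -scalerA [RHS]addrAC -scalerDr.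
Qed.

Lemma cdconj_slice (J : A) (z : plane) : imag_unit J ->
  cdconj (slice_point z J) = slice_point (cdconj z) J.
Proof.
move=> SJ; rewrite cdconjD cdconj_real cdconjZ cdconjE.
by have [-> _] := (imag_unitP J).1 SJ; rewrite mulr0 cdreal0 sub0r scalerN -scaleNr.
Qed.

Lemma slice_mul (J x : A) (z : plane) :
  cdmul (slice_point z J) x = z.1 *: x + z.2 *: cdmul J x.
Proof. by rewrite cdmulDl cdmul_reall cdmulZl. Qed.

(** The expansion of [(d1 - d2 J)(q + z2 J) / |d|^2], with [d = Delta_coord y z] and [q = z1 - y^c],
    sorted into terms without [J] and terms with [J] on the left. *)
Definition stem_recip (y : A) : stem R k :=
  (fun z => (normsq (Delta_coord y z))^-1 *:
    ((Delta_coord y z).1 *: (cdreal k z.1 - cdconj y) +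
     ((Delta_coord y z).2 * z.2) *: cdreal k 1),
   fun z => (normsq (Delta_coord y z))^-1 *:
    (((Delta_coord y z).1 * z.2) *: cdreal k 1 -
     (Delta_coord y z).2 *: (cdreal k z.1 - cdconj y))).

Lemma is_stem_recip (y : A) : is_stem (slice_recip y) (stem_recip y).
Proof.
have E1 w : (stem_recip y).1 w = (normsq (Delta_coord y w))^-1 *:
  ((Delta_coord y w).1 *: (cdreal k w.1 - cdconj y) +
   ((Delta_coord y w).2 * w.2) *: cdreal k 1) by [].
have E2 w : (stem_recip y).2 w = (normsq (Delta_coord y w))^-1 *:
  (((Delta_coord y w).1 * w.2) *: cdreal k 1 -
   (Delta_coord y w).2 *: (cdreal k w.1 - cdconj y)) by [].
split=> [z _|z J _ SJ].
  have Dc : Delta_coord y (cdconj z) = cdconj (Delta_coord y z).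
    by rewrite /Delta_coord /= sqrrN mulrN.
  rewrite !E1 !E2 Dc normsq_conj; set d := Delta_coord y z; rewrite /= mulrNN; split => //.
  by rewrite mulrN !scaleNr opprK -[RHS]scalerN opprB; congr (_ *: _); exact: addrC.
rewrite /slice_recip Delta_slice// /cdinv cdconj_slice// normsq_slice// cdmulZl slice_mul.
rewrite E1 E2; move: (Delta_coord y z) => d.
have -> : slice_point z J - cdconj y = cdreal k z.1 - cdconj y + z.2 *: J.
  by rewrite /slice_point addrAC.
move: (cdreal k z.1 - cdconj y) => q.
rewrite cdmulZr -scalerDr; congr (_ *: _) => /=.
rewrite !cdmulDr !cdmulNr !cdmulZr SJ.
case: (cdmul1 J) => _ ->.
rewrite !scalerDr !scaleNr !scalerA !scalerN !opprK -!addrA; congr (_ + _).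
rewrite [RHS]addrCA; congr (_ + _).
exact: addrC.
Qed.

Lemma cplaneD (J a b : A) : cplane J a -> cplane J b -> cplane J (a + b).
Proof.
move=> [z ->] [w ->]; exists (z + w).
by rewrite /slice_point /= addrACA -scalerDl -cdrealD.
Qed.

Lemma cplaneZ (J a : A) (r : R) : cplane J a -> cplane J (r *: a).
Proof.
move=> [z ->]; exists (r *: z).
by rewrite /slice_point /= scalerDr scalerA -cdrealZ.
Qed.

Lemma cplaneN (J a : A) : cplane J a -> cplane J (- a).
Proof. by rewrite -scaleN1r; exact: cplaneZ. Qed.

Lemma cplane_real (J : A) (r : R) : cplane J (cdreal k r).
Proof. by exists (r, 0); rewrite /slice_point /= scale0r addr0. Qed.

Lemma cplane_conj (J a : A) : imag_unit J -> cplane J a -> cplane J (cdconj a).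
Proof. by move=> SJ [z ->]; exists (cdconj z); exact: cdconj_slice. Qed.

Lemma cplaneM (J a b : A) : imag_unit J -> cplane J a -> cplane J b -> cplane J (cdmul a b).
Proof.
move=> SJ [z ->] Jb; rewrite slice_mul; apply: cplaneD; apply: cplaneZ => //.
case: Jb => w ->; rewrite cdmulDr cdmul_realr cdmulZr SJ.
apply: cplaneD; apply: cplaneZ; last exact/cplaneN/cplane_real.
by exists (0, 1); rewrite /slice_point /= cdreal0 add0r scale1r.
Qed.

(** If the left stem takes values in the plane of [J], these commute with [J], and [J (J x) = - x]
    suffices to move [J] past them; the slice product is then pointwise on that plane. *)
Lemma eval_stem_prod (J : A) (F G : stem R k) (z : plane) : imag_unit J ->
  cplane J (F.1 z) -> cplane J (F.2 z) ->
  eval_stem J (stem_prod F G) z = cdmul (eval_stem J F z) (eval_stem J G z).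
Proof.
move=> SJ [a aE] [b bE]; rewrite /eval_stem /= aE bE.
move: (G.1 z) (G.2 z) => c d {aE bE F G}.
have JK (x : A) : cdmul J (cdmul J x) = - x by exact: cdmul_unitK.
have -> : cdmul J (slice_point b J) = slice_point (- b.2, b.1) J.
  rewrite cdmulDr cdmul_realr cdmulZr SJ scalerN -cdrealZ mulr1 addrC.
  by rewrite /slice_point /= cdrealN.
have aJd : cdmul (slice_point a J) (cdmul J d) = cdmul J (cdmul (slice_point a J) d).
  by rewrite !slice_mul cdmulDr !cdmulZr.
have bJc : cdmul (slice_point (- b.2, b.1) J) c = cdmul J (cdmul (slice_point b J) c).
  by rewrite !slice_mul cdmulDr !cdmulZr JK scalerN scaleNr addrC.
have bJd : cdmul (slice_point (- b.2, b.1) J) (cdmul J d) = - cdmul (slice_point b J) d.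
  by rewrite !slice_mul JK scalerN scaleNr opprD addrC.
rewrite cdmulDl !cdmulDr aJd bJc bJd -!addrA; congr (_ + _).
by rewrite addrC -addrA.
Qed.

Lemma stem_exp_cplane (J : A) (F : stem R k) (z : plane) n : imag_unit J ->
  cplane J (F.1 z) -> cplane J (F.2 z) ->
  cplane J ((stem_exp F n).1 z) /\ cplane J ((stem_exp F n).2 z).
Proof.
move=> SJ F1 F2; elim: n => [|n [IH1 IH2]] /=.
  by split; [exact: cplane_real|have := cplane_real J 0; rewrite cdreal0].
split; last by apply: cplaneD; exact: cplaneM.
by apply: cplaneD; [exact: cplaneM|apply/cplaneN/cplaneM].
Qed.

Definition slice_embed (J : A) (s : C) : A := slice_point (plane_of s) J.

Lemma slice_embedA (J x : A) (s t : C) : imag_unit J ->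
  cdmul (slice_embed J s) (cdmul (slice_embed J t) x) = cdmul (slice_embed J (s * t)) x.
Proof.
move=> SJ; rewrite /slice_embed !slice_mul cdmulDr !cdmulZr cdmul_unitK//.
case: s t => [a b] [c d] /=.
rewrite [in RHS]scalerBl [in RHS]scalerDl !scalerDr !scalerA scalerN.
by rewrite [X in _ + X = _]addrC addrACA.
Qed.

Lemma slice_embedM (J : A) (s t : C) : imag_unit J ->
  cdmul (slice_embed J s) (slice_embed J t) = slice_embed J (s * t).
Proof.
move=> SJ; have [_ E] := cdmul1 (slice_embed J t).
by rewrite -[in LHS]E slice_embedA//; case: (cdmul1 (slice_embed J (s * t))).
Qed.

Lemma slice_embed1 (J : A) : slice_embed J 1 = cdreal k 1.
Proof. by rewrite /slice_embed /slice_point /= scale0r addr0. Qed.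

Lemma eval_stem_exp (J : A) (F : stem R k) (z : plane) (s : C) n : imag_unit J ->
  cplane J (F.1 z) -> cplane J (F.2 z) -> eval_stem J F z = slice_embed J s ->
  eval_stem J (stem_exp F n) z = slice_embed J (s ^+ n).
Proof.
move=> SJ F1 F2 E; elim: n => [|n IH].
  by rewrite slice_embed1 /eval_stem /= cdmulx0 addr0.
by rewrite eval_stem_prod// E IH slice_embedM// exprS.
Qed.

(** On the plane of [J] one has [Delta_y(x) = (x - y)(x - y^c)], so [slice_recip y] is the ordinary
    inverse of [x - y] away from [y] and [y^c], where it is 0 by convention. The last two hypotheses
    exclude these points. *)
Lemma laurent_term_eval (y J a : A) (z z0 : plane) (s : C) (n : int) :
  imag_unit J -> y = slice_point z0 J -> z = z0 + plane_of s -> s != 0 -> z != cdconj z0 ->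
  laurent_term y (fun=> a) n (slice_point z J) = cdmul (slice_embed J (s ^ n)) a.
Proof.
move=> SJ yE zE s0 zz0.
have Jy : cplane J y by exists z0.
have key (f : A -> A) (F : stem R k) (t : C) m : is_stem f F ->
    cplane J (F.1 z) -> cplane J (F.2 z) -> f (slice_point z J) = slice_embed J t ->
    slice_prod (slice_exp f m) (fun=> a) (slice_point z J) = cdmul (slice_embed J (t ^+ m)) a.
  move=> fF F1 F2 ft.
  have [E1 E2] := stem_exp_cplane m SJ F1 F2.
  have [_ ->] // := is_stem_prod (is_stem_exp m fF) (is_stem_cst a).
  rewrite -/(eval_stem J _ z) eval_stem_prod// (@eval_stem_exp _ _ _ t)//.
    by rewrite /eval_stem /= cdmulx0 addr0.
  by rewrite -ft; have [_ ->] := fF.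
have subE : slice_point z J - slice_point z0 J = slice_embed J s.
  by rewrite slice_pointB zE addrC addKr.
case: n => m; rewrite /laurent_term /slice_pow.
- rewrite -exprnP; apply: (key _ _ _ _ (is_stem_sub y)).
  + by apply: cplaneD; [exact: cplane_real|exact: cplaneN].
  + exact: cplane_real.
  + by rewrite yE.
rewrite NegzE -exprnN -exprVn; apply: (key _ _ _ _ (is_stem_recip y)).
- apply/cplaneZ/cplaneD; apply: cplaneZ; last exact: cplane_real.
  by apply: cplaneD; [exact: cplane_real|exact/cplaneN/cplane_conj].
- apply/cplaneZ/cplaneD; first exact/cplaneZ/cplane_real.
  apply/cplaneN/cplaneZ; apply: cplaneD; first exact: cplane_real.
  exact/cplaneN/cplane_conj.
rewrite /slice_recip Delta_slice// yE cdconj_slice// slice_pointB.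
pose t : C := (z - cdconj z0).1 +i* (z - cdconj z0).2.
have tE : slice_point (z - cdconj z0) J = slice_embed J t by [].
have t0 : t != 0.
  apply: contra zz0; rewrite eq_complex /= => /andP[/eqP t1 /eqP t2].
  rewrite -subr_eq0; apply/eqP; rewrite [LHS]surjective_pairing.
  by congr pair; [exact: t1|exact: t2].
have DE : slice_point (Delta_coord (slice_point z0 J) z) J = slice_embed J (s * t).
  congr slice_point; rewrite /Delta_coord normsq_slice// cdre_slice// /t zE.
  by case: s z0 {yE zE s0 zz0 subE t tE t0} => [u v] [b c] /=; congr pair => /=; ring.
have invE w : cdinv (slice_embed J w) = slice_embed J w^-1.
  rewrite /cdinv /slice_embed normsq_slice// cdconj_slice// /slice_point scalerDr scalerA -cdrealZ.
  by case: w => u v /=; congr (cdreal k _ + _ *: _); rewrite mulrC ?mulNr.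
rewrite tE DE invE slice_embedM//; congr slice_embed.
by rewrite invfM mulfVK.
Qed.

End SliceFunctions.

(** * Continuity of the algebra operations *)

Section Limits.
Variable R : realType.

Lemma cvg_component (T : Type) (F : set_system T) {FF : Filter F} (V W : normedModType R)
    (u : T -> V * W) (l : V * W) : u @ F --> l ->
  (u t).1 @[t --> F] --> l.1 /\ (u t).2 @[t --> F] --> l.2.
Proof.
move=> ul; split.
- have c1 : q.1 @[q --> l] --> l.1 by exact: cvg_fst.
  exact: (cvg_comp _ _ ul c1).
- have c2 : q.2 @[q --> l] --> l.2 by exact: cvg_snd.
  exact: (cvg_comp _ _ ul c2).
Qed.

Lemma cvg_cdconj k (T : Type) (F : set_system T) {FF : Filter F} (u : T -> cd R k) (l : cd R k) :
  u @ F --> l -> cdconj (u t) @[t --> F] --> cdconj l.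
Proof.
elim: k u l => [//|k IH] u l /cvg_component[u1 u2] /=.
exact: (cvg_pair (IH _ _ u1) (cvgN u2)).
Qed.

(** Both sides go through the induction together, since the doubling formula for each involves the
    other. *)
Lemma cvg_cdmul k (T : Type) (F : set_system T) {FF : Filter F} (a : cd R k)
    (u : T -> cd R k) (l : cd R k) : u @ F --> l ->
  cdmul a (u t) @[t --> F] --> cdmul a l /\ cdmul (u t) a @[t --> F] --> cdmul l a.
Proof.
elim: k a u l => [|k IH] a u l.
  by move=> ul; split; [exact: (@cvgMl_tmp R)|exact: (@cvgMr_tmp R)].
move=> /cvg_component[u1 u2] /=.
have IHl b (v : T -> cd R k) (m : cd R k) : v @ F --> m -> cdmul b (v t) @[t --> F] --> cdmul b m.
  by move=> /(IH b)[].
have IHr b (v : T -> cd R k) (m : cd R k) : v @ F --> m -> cdmul (v t) b @[t --> F] --> cdmul m b.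
  by move=> /(IH b)[].
have v1 : cdconj (u t).1 @[t --> F] --> cdconj l.1 by exact: cvg_cdconj u1.
have v2 : cdconj (u t).2 @[t --> F] --> cdconj l.2 by exact: cvg_cdconj u2.
have c1 : (cdmul a.1 (u t).1 - cdmul (cdconj (u t).2) a.2) @[t --> F] -->
  cdmul a.1 l.1 - cdmul (cdconj l.2) a.2 by exact: cvgB (IHl _ _ _ u1) (IHr _ _ _ v2).
have c2 : (cdmul (u t).2 a.1 + cdmul a.2 (cdconj (u t).1)) @[t --> F] -->
  cdmul l.2 a.1 + cdmul a.2 (cdconj l.1) by exact: cvgD (IHr _ _ _ u2) (IHl _ _ _ v1).
have c3 : (cdmul (u t).1 a.1 - cdmul (cdconj a.2) (u t).2) @[t --> F] -->
  cdmul l.1 a.1 - cdmul (cdconj a.2) l.2 by exact: cvgB (IHr _ _ _ u1) (IHl _ _ _ u2).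
have c4 : (cdmul a.2 (u t).1 + cdmul (u t).2 (cdconj a.1)) @[t --> F] -->
  cdmul a.2 l.1 + cdmul l.2 (cdconj a.1) by exact: cvgD (IHl _ _ _ u1) (IHr _ _ _ u2).
by split; [exact: (cvg_pair c1 c2)|exact: (cvg_pair c3 c4)].
Qed.

Lemma cvg_cdre k (T : Type) (F : set_system T) {FF : Filter F} (u : T -> cd R k) (l : cd R k) :
  u @ F --> l -> cdre (u t) @[t --> F] --> cdre l.
Proof. by elim: k u l => [//|k IH] u l /cvg_component[u1 _] /=; exact: IH u1. Qed.

Lemma cvg_normsq k (T : Type) (F : set_system T) {FF : Filter F} (u : T -> cd R k) (l : cd R k) :
  u @ F --> l -> normsq (u t) @[t --> F] --> normsq l.
Proof.
elim: k u l => [|k IH] u l.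
  by move=> ul /=; rewrite expr2; under eq_fun do rewrite expr2; exact: (@cvgM R).
by move=> /cvg_component[u1 u2] /=; exact: (cvgD (IH _ _ u1) (IH _ _ u2)).
Qed.

Lemma sqr_norm_le_normsq k (x : cd R k) : `|x| ^+ 2 <= normsq x.
Proof.
elim: k x => [|k IH] x; first by rewrite /= real_normK ?num_real.
rewrite prod_normE /=; have := IH x.1; have := IH x.2.
have := normsq_ge0 x.1; have := normsq_ge0 x.2.
by case: (leP `|x.1| `|x.2|); lra.
Qed.

(** A set that contains the imaginary units and whose compactness follows by induction on the
    doubling. *)
Fixpoint unit_box k : set (cd R k) :=
  match k return set (cd R k) with
  | 0 => `[-1, 1]%classic : set R
  | k'.+1 => @unit_box k' `*` @unit_box k' : set (cd R k' * cd R k')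
  end.

Lemma compact_unit_box k : compact (@unit_box k).
Proof. by elim: k => [|k IH]; [exact: segment_compact|exact: compact_setX]. Qed.

Lemma normsq_unit_box k (x : cd R k) : normsq x <= 1 -> unit_box x.
Proof.
elim: k x => [|k IH] x /=.
  by move=> H; rewrite in_itv /= -ler_norml -(ler_pXn2r (n := 2)) ?nnegrE// real_normK ?num_real// expr1n.
move=> H; have := normsq_ge0 x.1; have := normsq_ge0 x.2.
by split; apply: IH; lra.
Qed.

End Limits.

(** * Two-sided series with finite principal part *)

Section Laurent.
Variables (R : realType) (k : nat).
Hypothesis hk : (1 <= k <= 3)%N.
Local Notation A := (cd R k).
Local Notation C := (R[i]).
Local Notation plane := (cd R 1).
Local Notation normc := (@normc R).
Local Open Scope complex_scope.

(* The coefficient of degree n is b (n + m), for n >= - m. *)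
Definition laurent_coef (b : nat -> A) (m : nat) (n : int) : A :=
  match n with
  | Posz j => b (j + m)%N
  | Negz j => if (j < m)%N then b (m - j.+1)%N else 0
  end.

Lemma laurent_coef_pole (b : nat -> A) (m : nat) (n : int) : n < - m%:Z -> laurent_coef b m n = 0.
Proof.
case: n => j; first by rewrite ltNge lerNl (le_trans (y := 0)) ?oppr_le0.
by rewrite NegzE ltrN2 ltz_nat ltnS /= => mj; rewrite ltnNge mj.
Qed.

Lemma cdmul_sum (a : A) (I : Type) (r : seq I) (P : pred I) (u : I -> A) :
  cdmul a (\sum_(i <- r | P i) u i) = \sum_(i <- r | P i) cdmul a (u i).
Proof. exact: (big_morph (cdmul a) (cdmulDr a) (cdmulx0 a)). Qed.

Lemma slice_embedK (J v : A) (s t : C) : imag_unit J -> s * t = 1 ->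
  cdmul (slice_embed J s) (cdmul (slice_embed J t) v) = v.
Proof. by move=> SJ st; rewrite slice_embedA// st slice_embed1; case: (cdmul1 v). Qed.

Lemma laurent_bisum (J v : A) (b : nat -> A) (m : nat) (s : C) : imag_unit J -> s != 0 ->
  series (fun n => cdmul (slice_embed J (s ^+ n)) (b n)) @ \oo --> cdmul (slice_embed J (s ^+ m)) v ->
  is_bisum (fun n : int => cdmul (slice_embed J (s ^ n)) (laurent_coef b m n)) v.
Proof.
move=> SJ s0 sv.
pose T : A := \sum_(0 <= i < m) cdmul (slice_embed J (s ^+ i)) (b i).
pose t := (s ^+ m)^-1.
have st : t * s ^+ m = 1 by rewrite mulVf ?expf_neq0.
exists (v - cdmul (slice_embed J t) T), (cdmul (slice_embed J t) T); split; last by rewrite subrK.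
- have -> : series (fun j => cdmul (slice_embed J (s ^ Posz j)) (laurent_coef b m (Posz j))) =
    (fun N => cdmul (slice_embed J t)
      (series (fun n => cdmul (slice_embed J (s ^+ n)) (b n)) (N + m)%N - T)).
    apply/funext => N; rewrite /series /=.
    have -> : \sum_(0 <= n < N + m) cdmul (slice_embed J (s ^+ n)) (b n) =
        T + \sum_(0 <= j < N) cdmul (slice_embed J (s ^+ (j + m))) (b (j + m)%N).
      rewrite (big_cat_nat (n := m)) ?leq_addl//=; congr (_ + _).
      by rewrite -{1}[m]add0n big_addn addnK.
    rewrite -/T addrAC subrr add0r cdmul_sum; apply: eq_bigr => j _.
    rewrite slice_embedA// -exprnP; congr (cdmul (slice_embed J _) _).
    by rewrite exprD mulrC -mulrA [_ * t]mulrC st mulr1.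
  have -> : v - cdmul (slice_embed J t) T = cdmul (slice_embed J t) (cdmul (slice_embed J (s ^+ m)) v - T).
    by rewrite cdmulDr cdmulNr slice_embedK.
  have sv' : series (fun n => cdmul (slice_embed J (s ^+ n)) (b n)) (N + m)%N @[N --> \oo] -->
    cdmul (slice_embed J (s ^+ m)) v by rewrite cvg_shiftn.
  exact: (cvg_cdmul _ (cvgB sv' (cvg_cst T))).1.
- apply: cvg_near_cst; exists m => // N /= mN.
  rewrite /series /= (big_cat_nat (n := m))//= [X in _ + X]big_nat_cond.
  rewrite [X in _ + X]big1 ?addr0; last first.
    by move=> j /andP[/andP[mj _] _]; rewrite ltnNge mj /= cdmulx0.
  (* The negative degrees run through [T] backwards: degree [-(j+1)] comes from index
     [m - (j+1)]. *)
  rewrite /T cdmul_sum [RHS]big_nat_rev /= add0n big_nat_cond [RHS]big_nat_cond.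
  apply: eq_bigr => j /andP[/andP[_ jm] _].
  rewrite jm slice_embedA//; congr (cdmul (slice_embed J _) _).
  rewrite NegzE -exprnN /t; apply: (mulIf (expf_neq0 j.+1 s0)).
  by rewrite mulVf ?expf_neq0// -mulrA -exprD subnK// mulVf ?expf_neq0.
Qed.

(** Evaluation at [J] sends [a + i b] to [a + J b] and turns multiplication by [s] into left
    multiplication by the image of [s] in the plane of [J]. *)
Lemma slice_embed_act (J a b : A) (s : C) : imag_unit J ->
  cdmul (slice_embed J s) (a + cdmul J b) = act1 s a b + cdmul J (act2 s a b).
Proof.
move=> SJ; rewrite /slice_embed slice_mul /= /act1 /act2 !cdmulDr !cdmulZr cdmul_unitK//.
by rewrite !scalerDr scalerN -!addrA; congr (_ + _); rewrite [RHS]addrCA; congr (_ + _); exact: addrC.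
Qed.

Lemma series_act (J : A) (b1 b2 : nat -> A) (s : C) (l1 l2 : A) : imag_unit J ->
  series (fun n => act1 (s ^+ n) (b1 n) (b2 n)) @ \oo --> l1 ->
  series (fun n => act2 (s ^+ n) (b1 n) (b2 n)) @ \oo --> l2 ->
  series (fun n => cdmul (slice_embed J (s ^+ n)) (b1 n + cdmul J (b2 n))) @ \oo --> l1 + cdmul J l2.
Proof.
move=> SJ s1 s2.
have -> : series (fun n => cdmul (slice_embed J (s ^+ n)) (b1 n + cdmul J (b2 n))) =
    (fun N => series (fun n => act1 (s ^+ n) (b1 n) (b2 n)) N +
       cdmul J (series (fun n => act2 (s ^+ n) (b1 n) (b2 n)) N)).
  apply/funext => N; rewrite /series /= cdmul_sum -big_split /=.
  by apply: eq_bigr => n _; rewrite slice_embed_act.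
exact: (cvgD s1 (cvg_cdmul J s2).1).
Qed.

End Laurent.

(** * Neighbourhoods of a sphere *)

Section Geometry.
Variables (R : realType) (k : nat).
Hypothesis hk : (1 <= k <= 3)%N.
Local Notation A := (cd R k).
Local Notation C := (R[i]).
Local Notation plane := (cd R 1).
Local Notation normc := (@normc R).
Local Open Scope complex_scope.

Let k0 : (0 < k)%N. Proof. by case/andP: hk. Qed.

(* At a real point the stem is invariant under conjugation, so averaging its expansion
   with the conjugate one removes the second components of the coefficients; the
   coefficients then no longer depend on the slice. *)
Lemma stem_expansion_real (z0 : plane) (F : stem R k) (D : set plane) (m : nat) (r : R)
    (b1 b2 : nat -> A) : z0.2 = 0 -> stem_on D F ->
  (forall s, punctured_disc r s -> D (z0 + plane_of s)) ->
  (forall s : C, punctured_disc r s ->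
    series (fun n => act1 (s ^+ n) (b1 n) (b2 n)) @ \oo -->
      act1 (s ^+ m) (F.1 (z0 + plane_of s)) (F.2 (z0 + plane_of s)) /\
    series (fun n => act2 (s ^+ n) (b1 n) (b2 n)) @ \oo -->
      act2 (s ^+ m) (F.1 (z0 + plane_of s)) (F.2 (z0 + plane_of s))) ->
  forall s : C, punctured_disc r s ->
    series (fun n => act1 (s ^+ n) (b1 n) 0) @ \oo -->
      act1 (s ^+ m) (F.1 (z0 + plane_of s)) (F.2 (z0 + plane_of s)) /\
    series (fun n => act2 (s ^+ n) (b1 n) 0) @ \oo -->
      act2 (s ^+ m) (F.1 (z0 + plane_of s)) (F.2 (z0 + plane_of s)).
Proof.
move=> z02 HF Dd HE s sr.
have sr' : punctured_disc r s^*.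
  by move: sr; rewrite /punctured_disc /mkset; case: s => a b /=; rewrite sqrrN.
have [s1 s2] := HE s sr; have [c1 c2] := HE _ sr'.
have conjE : z0 + plane_of s^* = cdconj (z0 + plane_of s).
  by case: z0 s z02 {HE Dd sr sr' s1 s2 c1 c2} => a b [u v] /= ->; congr pair; rewrite /= !add0r.
have [F1 F2] := HF _ (Dd s sr); rewrite conjE F1 F2 in c1 c2.
have conjX n : (s^* ^+ n) = (s ^+ n)^* by rewrite rmorphXn.
have a1 (w : C) (a b : A) : act1 w^* a b = act1 w a (- b).
  by case: w => u v; rewrite /act1 /= scaleNr scalerN.
have a2 (w : C) (a b : A) : act2 w^* a b = - act2 w a (- b).
  by case: w => u v; rewrite /act2 /= scaleNr scalerN opprD opprK.
have half (a : A) : 2^-1 *: (a + a) = a.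
  by rewrite -mulr2n -[a *+ 2]scaler_nat scalerA mulVf ?scale1r// pnatr_eq0.
(* The conjugate expansion has the same first limit and the opposite second limit; hence the half
   sum and the half difference below. *)
rewrite conjX a1 opprK in c1; rewrite conjX a2 opprK in c2.
split.
- have -> : series (fun n => act1 (s ^+ n) (b1 n) 0) = (fun N => 2^-1 *:
      (series (fun n => act1 (s ^+ n) (b1 n) (b2 n)) N +
       series (fun n => act1 (s^* ^+ n) (b1 n) (b2 n)) N)).
    apply/funext => N; rewrite /series /= -big_split /= scaler_sumr.
    apply: eq_bigr => n _; rewrite conjX a1 /act1 scalerN scaler0 subr0 opprK.
    by rewrite addrACA addNr addr0 half.
  rewrite -[X in _ --> X]half.
  exact: (cvgZl_tmp (cvgD s1 c1)).
- have -> : series (fun n => act2 (s ^+ n) (b1 n) 0) = (fun N => 2^-1 *: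
      (series (fun n => act2 (s ^+ n) (b1 n) (b2 n)) N -
       series (fun n => act2 (s^* ^+ n) (b1 n) (b2 n)) N)).
    apply/funext => N; rewrite /series /= -sumrB /= scaler_sumr.
    apply: eq_bigr => n _; rewrite conjX a2 opprK /act2 scaler0 add0r scalerN.
    by rewrite addrACA subrr add0r half.
  rewrite -[X in _ --> X]half -[X in _ --> _ *: (_ + X)]opprK.
  exact: (cvgZl_tmp (cvgB s2 c2)).
Qed.

Lemma slice_point_unit_inj (z : plane) (J I : A) : z.2 != 0 ->
  slice_point z J = slice_point z I -> J = I.
Proof. by move=> z2 /addrI /(scalerI z2). Qed.

Lemma plane_ofK (z w : plane) : w + plane_of ((z - w).1 +i* (z - w).2) = z.
Proof.
by rewrite (_ : plane_of _ = z - w) ?[w + _]addrC ?subrK//.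
Qed.

(* For non-real y and small r, only the slice of y meets the ball. *)
Lemma Sigma_ballP (y J0 : A) (z0 : plane) (r : R) : imag_unit J0 -> y = slice_point z0 J0 ->
  0 <= z0.2 -> (0 < z0.2 -> r <= z0.2) -> forall x, Sigma_ball y r x ->
  exists (J : A) (s : C), [/\ imag_unit J, y = slice_point z0 J,
    x = slice_point (z0 + plane_of s) J, punctured_disc r s & (0 < z0.2 -> J = J0)].
Proof.
move=> SJ0 yE z020 rz0 x [tau0 sigr].
have [[J [SJ [z xE] [z' yE']]]|nss] := pselect (same_slice x y); last first.
  (* A real [y] shares a plane with every [x]; for a non-real [y] without common plane, sigma is at
     least [z0.2 >= r]. *)
  have [z0p|] := ltrP 0 z0.2; last first.
    move=> z02; exfalso; apply: nss; have [J SJ xE] := slice_decomposition x k0.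
    exists J; split => //; first by exists (cdre x, enorm (cdim x)).
    exists z0; rewrite yE /slice_point.
    by have -> : z0.2 = 0 by [apply/eqP; rewrite eq_le z02]; rewrite !scale0r.
  exfalso; move: sigr; rewrite /dist_sigma asboolF// ltNge => /negP; apply.
  apply: le_trans (rz0 z0p) _.
  rewrite -[z0.2]ger0_norm// -(enorm_cdim_slice z0 SJ0) -yE.
  rewrite -[leLHS]ger0_norm ?sqrtr_ge0// -sqrtr_sqr ler_wsqrtr//.
  rewrite -[leLHS]add0r lerD ?sqr_ge0// ler_pXn2r ?nnegrE ?addr_ge0 ?sqrtr_ge0//.
  by rewrite lerDr sqrtr_ge0.
have xyE w (I : A) : imag_unit I -> x = slice_point w I -> y = slice_point z0 I ->
    punctured_disc r ((w - z0).1 +i* (w - z0).2).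
  move=> SI xI yI; move: tau0 sigr; rewrite /dist_sigma /dist_tau.
  have ss : same_slice x y by exists I; split => //; [exists w|exists z0].
  rewrite !asboolT// xI yI slice_pointB /enorm normsq_slice//.
  by move=> h1 h2; apply/andP.
(* The common plane may present [y] by the conjugate coordinate; then the unit changes sign. *)
have [I [w [SI xI yI]]] : exists (I : A) (w : plane),
    [/\ imag_unit I, x = slice_point w I & y = slice_point z0 I].
  have : slice_point z0 J0 = slice_point z' J by rewrite -yE.
  move=> /(slice_point_inj SJ0 SJ)[z'E|z'E].
    by exists J, z; split => //; rewrite yE' z'E.
  exists (- J), (cdconj z); split; [exact: imag_unitN|by rewrite slice_point_conj|].
  by rewrite yE' -slice_point_conj z'E cdconjK.
exists I, ((w - z0).1 +i* (w - z0).2); split => //; first by rewrite plane_ofK.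
  exact: (xyE w I SI xI yI).
by move=> z0p; apply: (@slice_point_unit_inj z0); rewrite ?gt_eqF// -yI.
Qed.

(** The sphere has only the coordinates [z0] and its conjugate in the plane of [J]; for non-real [y]
    the latter is at distance [2 |z0.2|], beyond the reach of [s]. *)
Lemma sphere_punctured (y J0 J : A) (z0 : plane) (s : C) : imag_unit J0 -> imag_unit J ->
  y = slice_point z0 J0 -> s != 0 -> (z0.2 != 0 -> normc s < `|z0.2|) ->
  ~ sphere y (slice_point (z0 + plane_of s) J).
Proof.
move=> SJ0 SJ yE s0 sz0 [z [J1 [I1 [SJ1 SI1 yE1 xE]]]].
have H1 : z = z0 \/ z = cdconj z0 by apply: slice_point_inj SJ0 SJ1 _; rewrite -yE.
have H2 := slice_point_inj SI1 SJ (esym xE).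
have H : z0 + plane_of s = z0 \/ z0 + plane_of s = cdconj z0.
  by case: H2 => ->; case: H1 => ->; rewrite ?cdconjK; [left|right|right|left].
case: H => [/eqP|H].
  rewrite -subr_eq0 addrAC subrr add0r => /eqP E.
  have E1 : complex.Re s = 0 := congr1 fst E.
  have E2 : complex.Im s = 0 := congr1 snd E.
  by move: s0; rewrite eq_complex E1 E2 /= eqxx.
have E1 : complex.Re s = 0.
  by have := congr1 fst H; rewrite /= => /eqP; rewrite -subr_eq0 addrAC subrr add0r => /eqP.
have E2 : complex.Im s = - (2 * z0.2) by have := congr1 snd H; rewrite /=; lra.
have [z020|z020] := eqVneq z0.2 0.
  by move: s0; rewrite eq_complex E1 E2 z020 mulr0 oppr0 /= eqxx.
have := sz0 z020; have := normIm_le s; rewrite E2 normrN normrM ger0_norm//.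
by have : 0 < `|z0.2| by [rewrite normr_gt0]; lra.
Qed.

(** A tube lemma: by compactness one radius serves all units. The covering is taken over [unit_box],
    where the non-units are open and satisfy the implication trivially. *)
Lemma sphere_tube (y J0 : A) (z0 : plane) (U : set A) : imag_unit J0 -> y = slice_point z0 J0 ->
  set_nbhs (sphere y) U ->
  exists2 d : R, 0 < d & forall (s : C) (J : A), normc s < d -> imag_unit J ->
    U (slice_point (z0 + plane_of s) J).
Proof.
move=> SJ0 yE yU.
have ccr (r : R) : (cdreal k q) @[q --> r] --> cdreal k r.
  under eq_fun do rewrite cdrealE; rewrite cdrealE.
  by apply: cvgZr_tmp; exact: cvg_id.
have := @compact_unit_box R k => /compact_near_coveringP.
move=> /(_ C (nbhs (0 : C)) (fun s J => imag_unit J -> U (slice_point (z0 + plane_of s) J)) _).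
move=> NC; have [J _|d d0 dV] := (nbhs_normcP (0 : C) _).1 (NC _); last first.
  exists d => // s J sd SJ; apply: dV => //; first by rewrite subr0.
  by apply: normsq_unit_box; rewrite ((imag_unitP J).1 SJ).2.
have [SJ|nSJ] := pselect (imag_unit J).
  have SpJ : nbhs (slice_point z0 J) U by apply: yU; exists z0, J0, J.
  have cs : slice_point (z0 + plane_of p.2) p.1 @[p --> (J, 0 : C)] --> slice_point z0 J.
    have c2 : p.2 @[p --> (J, 0 : C)] --> (0 : C) by exact: cvg_snd.
    have c1 : p.1 @[p --> (J, 0 : C)] --> J by exact: cvg_fst.
    have r2 : (z0.1 + complex.Re p.2) @[p --> (J, 0 : C)] --> z0.1 + 0.
      by apply: cvgD; [exact: cvg_cst|exact: cvg_Re c2].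
    have i2 : (z0.2 + complex.Im p.2) @[p --> (J, 0 : C)] --> z0.2 + 0.
      by apply: cvgD; [exact: cvg_cst|exact: cvg_Im c2].
    rewrite addr0 in r2; rewrite addr0 in i2.
    apply: cvgD; last exact: (cvgZ i2 c1).
    exact: (cvg_comp _ _ r2 (ccr z0.1)).
  have H : \forall p \near (J, 0 : C), U (slice_point (z0 + plane_of p.2) p.1) := cs _ SpJ.
  by apply: filterS H => -[J' s] /= HU _.
have nuJ : \forall J' \near J, ~ imag_unit J'.
  have [re0|re0] := eqVneq (cdre J) 0.
    have n1 : normsq J - 1 != 0 by rewrite subr_eq0; apply/eqP => n1; apply/nSJ/imag_unitP.
    have c1 : (normsq q - 1) @[q --> J] --> normsq J - 1.
      by apply: cvgB; [apply: cvg_normsq; exact: cvg_id|exact: cvg_cst].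
    apply: filterS (cvgr_neq0 _ c1 n1) => J' + /imag_unitP[_ n2].
    by rewrite n2 subrr eqxx.
  have c1 : cdre q @[q --> J] --> cdre J by apply: cvg_cdre; exact: cvg_id.
  apply: filterS (cvgr_neq0 _ c1 re0) => J' + /imag_unitP[r2 _].
  by rewrite r2 eqxx.
exists ([set J' | ~ imag_unit J'], setT) => /=; first by split => //; exact: filterT.
by move=> [J' s] /= [nu _] /nu.
Qed.

End Geometry.

(** * From an avoided ball to a pole *)

Section Removal.
Variables (R : realType) (k : nat).
Hypothesis hk : (1 <= k <= 3)%N.
Local Notation A := (cd R k).
Local Notation C := (R[i]).
Local Notation plane := (cd R 1).
Local Open Scope complex_scope.

Lemma avoids_ball_pole (y J0 c : A) (z0 : plane) (D : set plane) (F : stem R k) (f : A -> A)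
    (rho e : R) :
  imag_unit J0 -> y = slice_point z0 J0 -> 0 <= z0.2 -> 0 < rho -> 0 < e ->
  (0 < z0.2 -> rho <= z0.2) -> open D -> (forall s, punctured_disc rho s -> D (z0 + plane_of s)) ->
  stem_on D F -> induces D F f -> C1_on D F.1 -> C1_on D F.2 ->
  (forall z, D z -> d_alpha F.1 z = d_beta F.2 z /\ d_beta F.1 z = - d_alpha F.2 z) ->
  (forall s J, punctured_disc rho s -> imag_unit J ->
     e ^+ 2 <= normsq (f (slice_point (z0 + plane_of s) J) - c)) ->
  exists (r : R) (a : int -> A) (m : nat), [/\ 0 < r, r <= rho, laurent_on f y r a &
    forall n : int, n < - m%:Z -> a n = 0].
Proof.
move=> SJ0 yE z02 rho0 e0 rhoz oD Dd stF indF c1 c2 CR far.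
have Fh := @stem_C1_hol R k D (punctured_disc rho) F.1 F.2 (d_alpha F.1) (d_beta F.1) z0 oD.
have [|//|m [r [b1 [b2 [r0 rrho bE]]]]] := stem_pole hk (c := c) rho0 e0 (Fh _ Dd).
- move=> z Dz; have [a1 a2 ca cb] := c1 z Dz; have [a3 a4 _ _] := c2 z Dz.
  have [E1 E2] := CR z Dz; split; last by split.
  by split; apply: DeriveDef => //; rewrite E2 opprK.
- by move=> s J sr SJ; rewrite -indF//; [exact: far|exact: Dd].
have sub s : punctured_disc r s -> punctured_disc rho s.
  by rewrite /punctured_disc /mkset => /andP[-> sr]; rewrite (lt_le_trans sr).
(* At a non-real [y] the ball lies in the plane of [J0], so the coefficients may be evaluated there;
   at a real [y] averaging removes [b2]. *)
pose b n := if z0.2 == 0 then b1 n else b1 n + cdmul J0 (b2 n).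
exists r, (laurent_coef b m), m; split => //; last by move=> n; exact: laurent_coef_pole.
move=> x xS.
have [|J [s [SJ yJ xE sr JJ0]]] := Sigma_ballP hk SJ0 yE z02 _ xS.
  by move=> z0p; apply: le_trans rrho _; exact: rhoz.
have s0 : s != 0 by rewrite -normc_gt0; case/andP: sr.
have zN : z0 + plane_of s != cdconj z0.
  apply/eqP => E.
  apply: (@sphere_punctured R k y J0 J z0 s SJ0 SJ yE s0).
    move=> z0n; have z0p : 0 < z0.2 by rewrite lt_def z0n.
    by rewrite ger0_norm//; case/andP: sr => _ /lt_le_trans; apply; rewrite (le_trans rrho) ?rhoz.
  by rewrite E; exists z0, J0, (- J); split => //;
    [exact: imag_unitN|rewrite -[J in LHS]opprK slice_point_conj].
have -> : (fun n => laurent_term y (laurent_coef b m) n x) =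
    (fun n : int => cdmul (slice_embed J (s ^ n)) (laurent_coef b m n)).
  apply/funext => n; rewrite xE.
  exact: (laurent_term_eval hk (laurent_coef b m n) n SJ yJ (erefl _) s0 zN).
apply: laurent_bisum => //.
rewrite xE indF//; last exact/Dd/sub.
rewrite slice_embed_act//.
have [z0z|z0n] := eqVneq z0.2 0.
  have Dr t : punctured_disc r t -> D (z0 + plane_of t) by move=> /sub; exact: Dd.
  have [e1 e2] := stem_expansion_real z0z stF Dr bE sr.
  have := series_act hk SJ e1 e2.
  by under eq_fun do rewrite cdmulx0 addr0; rewrite /b z0z eqxx.
have z0p : 0 < z0.2 by rewrite lt_def z0n.
have [e1 e2] := bE s sr.
have := series_act hk SJ e1 e2.
by rewrite /b (negbTE z0n) (JJ0 z0p).
Qed.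

End Removal.

Theorem theorem6p7 (R : realType) (k : nat) (hk : (1 <= k <= 3)%N)
  (Omt : set (cd R k)) (hcirc : circular Omt) (hopen : open Omt)
  (y : cd R k) (hy : Omt y)
  (f : cd R k -> cd R k) (hf : slice_regular (Omt `\` sphere y) f)
  (hess : essential_singularity (Omt `\` sphere y) f y)
  (U : set (cd R k)) (hU : U `<=` Omt) (hUn : set_nbhs (sphere y) U) :
  dense (f @` (U `\` sphere y)).
Proof.
move=> V [c Vc] oV; apply: contrapT => disj.
have k0 : (0 < k)%N by case/andP: hk.
have [e /= e0 eV] : exists2 e : R, 0 < e & ball c e `<=` V.
  exact/nbhs_ballP/open_nbhs_nbhs.
(* [ball] refers to the sup norm, which is at most the Euclidean norm, so a value at Euclidean
   distance below [e] from [c] would lie in [V]. *)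
have far x : U x -> ~ sphere y x -> e ^+ 2 <= normsq (f x - c).
  move=> Ux nx; rewrite leNgt; apply/negP => H.
  apply: disj; exists (f x); split; last by exists x.
  apply: eV; rewrite -ball_normE /ball_ /= distrC -(ltr_pXn2r (n := 2)) ?nnegrE// ?ltW//.
  exact: le_lt_trans (sqr_norm_le_normsq _) H.
have [J0 SJ0 yE] := slice_decomposition y k0.
set z0 := (_, _) in yE.
have z02 : 0 <= z0.2 := sqrtr_ge0 _.
have [d d0 dU] := sphere_tube SJ0 yE hUn.
(* The cap at [z0.2] keeps the conjugate of [z0] out of the disc and confines the ball at [y] to a
   single slice. *)
pose rho := if 0 < z0.2 then Num.min d z0.2 else d.
have rho0 : 0 < rho by rewrite /rho; case: ifP => // z0p; rewrite lt_min d0.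
have rhod : rho <= d by rewrite /rho; case: ifP => // _; rewrite ge_min lexx.
have rhoz : 0 < z0.2 -> rho <= z0.2 by rewrite /rho => ->; rewrite ge_min lexx orbT.
have dom s J : punctured_disc rho s -> imag_unit J ->
    U (slice_point (z0 + plane_of s) J) /\ ~ sphere y (slice_point (z0 + plane_of s) J).
  move=> /andP[s0 sr] SJ; split; first by apply: dU => //; exact: lt_le_trans rhod.
  apply: (@sphere_punctured R k y J0 J z0 s SJ0 SJ yE); first by rewrite -normc_gt0.
  move=> z0n; rewrite ger0_norm//; apply: lt_le_trans sr (rhoz _).
  by rewrite lt_def z0n.
have [D [F [[Dn0 conjD oD OmD] [stF indF c1 c2 CR]]]] := hf.
have Dd s : punctured_disc rho s -> D (z0 + plane_of s).
  move=> sr; have [Us ns] := dom s J0 sr SJ0.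
  have : (Omt `\` sphere y) (slice_point (z0 + plane_of s) J0) by split => //; exact: hU.
  rewrite OmD => -[z [J [Dz SJ E]]].
  (* A point fixes its planar coordinate up to conjugation, and [D] is invariant under that. *)
  by have [->|->] := slice_point_inj SJ SJ0 (esym E); [|exact: conjD].
have [|r [a [m [r0 rrho aE am]]]] := avoids_ball_pole hk SJ0 yE z02 rho0 e0 rhoz oD Dd stF indF
  c1 c2 CR (c := c).
  by move=> s J sr SJ; have [Us ns] := dom s J sr SJ; exact: far.
apply: hess.2; exists r, a; split => //; last by exists m.
move=> x xS.
have [|J [s [SJ _ -> sr _]]] := Sigma_ballP hk SJ0 yE z02 _ xS.
  by move=> z0p; apply: le_trans rrho (rhoz z0p).
have sr' : punctured_disc rho s by move: sr => /andP[s0 sr]; apply/andP; split=> //; exact: lt_le_trans rrho.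
by have [Us ns] := dom s J sr' SJ; split => //; exact: hU.
Qed.
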